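(* Let $k$ be an even positive integer, let $G$ be a graph in which every vertex has even degree, and let $f:V(G)\to\mathbb{Z}_2$ be a mapping with $\sum_{v\in V(G)} f(v)\equiv 0\pmod 2$. If $d_G(X)\ge 3k-2$ for every vertex set $X$ with $\sum_{v\in X} f(v)$ odd, or if $G$ is $(2k-2)$-tree-connected, then $G$ can be edge-decomposed into $f$-parity factors $G_1,\ldots,G_k$ such that for each $i$ and each vertex $v$, $$|d_{G_i}(v)-d_G(v)/k|<2.$$
   Context: Graphs are finite and may have loops and multiple edges; a loop contributes $2$ to the degree $d_G(v)$. For a vertex set $X$, $d_G(X)$ denotes the number of edges with exactly one end in $X$. A graph is $m$-tree-connected if it contains $m$ edge-disjoint spanning trees. An $f$-parity factor is a spanning subgraph $F$ such that $d_F(v)\equiv f(v)\pmod 2$ for every vertex $v$. ''Edge-decomposed into factors'' means the edge set is partitioned into the edge sets of spanning subgraphs. *)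

(* Defs.v *)
From HB Require Import structures.
From mathcomp Require Import all_boot all_order all_algebra.

Set Implicit Arguments.
Unset Strict Implicit.
Unset Printing Implicit Defensive.

Import Order.TTheory GRing.Theory Num.Theory.

(** The pair [ends e] is unordered in meaning: every notion below is symmetric
    in its two components.  A loop is an edge with equal components, and
    distinct edges may have the same ends. *)
Record multigraph := Multigraph {
  vertex : finType;
  edge : finType;
  ends : edge -> vertex * vertex
}.

Section Multigraph.
Variable G : multigraph.
Implicit Types (F : {set edge G}) (X : {set vertex G}).

(** A spanning subgraph of [G] is identified with its edge set [F]. *)

Definition joins (e : edge G) (u v : vertex G) : bool :=
  (ends e == (u, v)) || (ends e == (v, u)).

Definition degree F (v : vertex G) : nat :=
  \sum_(e in F) (((ends e).1 == v) + ((ends e).2 == v)).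

Definition cut_size X : nat :=
  #|[set e : edge G | ((ends e).1 \in X) (+) ((ends e).2 \in X)]|.

Definition adjacent F : rel (vertex G) :=
  fun u v => [exists e in F, joins e u v].

Definition connected_factor F : Prop :=
  forall u v, connect (adjacent F) u v.

(** A cycle v_1 e_1 v_2 e_2 ... v_n e_n (back to v_1) is the sequence of the
    pairs (v_i, e_i).  A loop is a cycle of length 1 and two parallel edges
    form a cycle of length 2. *)
Definition is_cycle F (c : seq (vertex G * edge G)) : bool :=
  [&& c != [::], uniq (unzip1 c), uniq (unzip2 c),
      all (mem F) (unzip2 c) &
      cycle (fun p q => joins p.2 p.1 q.1) c].

Definition acyclic_factor F : Prop := forall c, ~~ is_cycle F c.

Definition spanning_tree F : Prop := connected_factor F /\ acyclic_factor F.

Definition tree_connected (m : nat) : Prop :=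
  exists T : 'I_m -> {set edge G},
    (forall i, spanning_tree (T i)) /\
    (forall i j, i != j -> [disjoint T i & T j]).

Definition parity_factor (f : vertex G -> 'Z_2) F : Prop :=
  forall v, ((degree F v)%:R = f v)%R.

(** Some of the factors may have no edges. *)
Definition edge_decomposition (k : nat) (D : 'I_k -> {set edge G}) : Prop :=
  (\bigcup_(i < k) D i = [set: edge G]) /\
  (forall i j, i != j -> [disjoint D i & D j]).

End Multigraph.

Arguments tree_connected : clear implicits.

(* Main.v *)
Require Import Defs.
From HB Require Import structures.
From mathcomp Require Import all_boot all_order all_algebra.
From mathcomp Require Import zify ring lra.

(** Suppose [G] has an orientation in which out-degree minus in-degree at [v] is
    congruent to [k * f v] modulo [2k].  Then the out- and in-degrees at [v] have
    a common residue [s] modulo [k].  Split [v] into an out-copy and an in-copy,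
    join the two copies by [k - s] dummy edges, and take an equitable [k]-colouring
    of this bipartite graph in which the dummy edges at [v] receive distinct
    colours: every colour occurs equally often at the out-copies and equally often
    at the in-copies, so the real degrees of [v] in two colours differ by 0 or 2.

    The orientation comes from the theorem of Lovasz, Thomassen, Wu and Zhang, in
    a form where the edges at one extra vertex [z0] are oriented in advance and
    [d(A) >= 2k - 2 + t(A)] is assumed for the proper subsets [A] of the other
    vertices, where [t(A)] is the distance from the prescribed net out-degree of
    [A] to the multiples of [2k].  An inclusion-minimal set [A] violating this
    inequality is contracted; the contracted graph is oriented by induction, and
    the inside of [A] by the theorem, with the rest of the graph playing the role
    of [z0].  If [A] is a single vertex, then it is removed by splitting off pairs
    of its edges so as to preserve the cuts of odd sets, respectively the
    edge-disjoint connected factors. *)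

Set Implicit Arguments.
Unset Strict Implicit.
Unset Printing Implicit Defensive.

Import Order.TTheory GRing.Theory Num.Theory.

Local Open Scope ring_scope.

(** * Distance to the multiples of 2k *)

Section Distance.

Variable k : nat.

(** Let the out- and in-degree of $v$ be $Bk+s$ and $Ck+s$. A congruence modulo $2k$ rather than $k$
    fixes the parity of $B-C$, hence of $B+C$; the factors have degree $B+C$ or $B+C+2$ at $v$,
    against an average of $B+C+2s/k$ with $s<k$. The strict bound fails only if $B+C+2$ occurs with
    $s=0$; then there are $k$ dummy edges, one of each colour, and this is excluded. Since $k$ is
    even, $k f(v)$ has the parity of $d(v)$, as a net out-degree must.

    Neither assumption yields the cut inequality for all sets: $t\le k$, so $3k-2=(2k-2)+k$ suffices
    for odd sets, but even ones may have small cuts, and $2k-2$ disjoint trees only guarantee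
    $d(A)\ge 2k-2$. A minimal violator $A$ is useful for two reasons: its proper subsets satisfy the
    inequality, and the failure at $A$ itself bounds the number of edges at $z_0$, which is the
    bound that the extension theorem requires there. *)

Definition cong (a b : int) := exists m : int, a = b + m * (2 * k%:Z).

Definition dist2k (n : int) : nat :=
  let r := modz n (2 * k%:Z) in absz (Num.min r (2 * k%:Z - r)).

Lemma cong_refl a : cong a a.
Proof. by exists 0; lia. Qed.

Lemma cong_sym a b : cong a b -> cong b a.
Proof. by case=> m ->; exists (- m); lia. Qed.

Lemma congD a b c d : cong a b -> cong c d -> cong (a + c) (b + d).
Proof. by case=> m -> [n ->]; exists (m + n); lia. Qed.

Lemma congN a b : cong a b -> cong (- a) (- b).
Proof. by case=> m ->; exists (- m); lia. Qed.

Hypothesis k_gt1 : (1 < k)%N.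

Lemma dist2kP (n : int) : exists m : int,
  (dist2k n)%:Z <= k%:Z /\
  (n = m * (2 * k%:Z) + (dist2k n)%:Z \/ n = m * (2 * k%:Z) - (dist2k n)%:Z).
Proof.
rewrite /dist2k; set K := 2 * k%:Z.
have K0 : 0 < K by rewrite /K; lia.
have := divz_eq n K; have := modz_ge0 n (lt0r_neq0 K0); have := ltz_pmod n K0.
move: (divz n K) (modz n K) => m r lt_r ge_r ->.
case: (lerP r (K - r)) => h.
  by exists m; split; [rewrite /K in h *|left; rewrite /K]; lia.
by exists (m + 1); split; [rewrite /K in h lt_r *|right; rewrite /K in lt_r *]; lia.
Qed.

Lemma dist2k_min (n m : int) : (dist2k n)%:Z <= `|n - m * (2 * k%:Z)|.
Proof.
rewrite /dist2k; set K := 2 * k%:Z.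
have K0 : 0 < K by rewrite /K; lia.
have := divz_eq n K; have := modz_ge0 n (lt0r_neq0 K0); have := ltz_pmod n K0.
move: (divz n K) (modz n K) => j r lt_r ge_r ->.
have -> : j * K + r - m * (2 * k%:Z) = (j - m) * K + r by rewrite /K; lia.
move: (j - m) => i.
have -> : (absz (Num.min r (K - r)))%:Z = Num.min r (K - r) by case: (lerP r (K - r)); lia.
case: (lerP 0 i) => i0.
  have : 0 <= i * K by apply: mulr_ge0; lia.
  by case: (lerP r (K - r)); lia.
have : (i + 1) * K <= 0 by apply: mulr_le0_ge0; lia.
by case: (lerP r (K - r)); lia.
Qed.

Lemma dist2k_cong (a b : int) : cong a b -> dist2k a = dist2k b.
Proof.
case=> m ->.
have [i [_ hi]] := dist2kP b; have [j [_ hj]] := dist2kP (b + m * (2 * k%:Z)).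
have := dist2k_min (b + m * (2 * k%:Z)) (i + m).
by have := dist2k_min b (j - m); lia.
Qed.

Lemma dist2k_lip (n m : int) : (dist2k (n + m))%:Z <= (dist2k n)%:Z + `|m|.
Proof.
have [i [_ hi]] := dist2kP n.
by have := dist2k_min (n + m) i; lia.
Qed.

Lemma dist2kN (n : int) : dist2k (- n) = dist2k n.
Proof.
have [i [_ hi]] := dist2kP n; have [j [_ hj]] := dist2kP (- n).
have := dist2k_min n (- j); have := dist2k_min (- n) (- i); lia.
Qed.

Lemma dist2kD (n m : int) : (dist2k (n + m) <= dist2k n + dist2k m)%N.
Proof.
have [i [_ hi]] := dist2kP n; have [j [_ hj]] := dist2kP m.
have := dist2k_min (n + m) (i + j); lia.
Qed.

Lemma dist2k_le (n : int) : (dist2k n <= k)%N.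
Proof. by have [i [h _]] := dist2kP n; lia. Qed.

(** The modulus is even, so the distance has the parity of [n]. As [bnd] will have the parity of
    [beta], a strict inequality between [demand] and [bnd] is then a gap of at least two. *)
Lemma dist2k_par (n : int) : exists m : int, n = (dist2k n)%:Z + m *+ 2.
Proof.
have [i [_ [h|h]]] := dist2kP n.
  by exists (i * k%:Z); lia.
by exists (i * k%:Z - (dist2k n)%:Z); lia.
Qed.

Lemma dist2k_eq0 (n : int) : dist2k n = 0%N <-> cong n 0.
Proof.
split=> [h|/dist2k_cong ->]; last by have := dist2k_min 0 0; lia.
by have [i [_ hi]] := dist2kP n; exists i; lia.
Qed.

Lemma dist2k_dec (n : int) : (dist2k (n - 1%:Z) <= dist2k n + 1)%N /\
  (dist2k n <= dist2k (n - 1%:Z) + 1)%N.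
Proof.
have := dist2k_lip n (- 1%:Z); have := dist2k_lip (n - 1%:Z) 1%:Z.
by rewrite subrK; lia.
Qed.

Lemma dist2k_inc (n : int) : (dist2k (n + 1%:Z) <= dist2k n + 1)%N.
Proof. by have := dist2k_lip n 1%:Z; lia. Qed.

Lemma dist2k_step (n : int) : (0 < dist2k n)%N ->
  (dist2k (n - 1%:Z) < dist2k n)%N \/ (dist2k (n + 1%:Z) < dist2k n)%N.
Proof.
move=> n0; have [i [_ [h|h]]] := dist2kP n.
  by left; have := dist2k_min (n - 1%:Z) i; lia.
by right; have := dist2k_min (n + 1%:Z) i; lia.
Qed.

(** Not getting closer under [n + 1] means lying above the nearest multiple; distance [k] is
    excluded, since there the next multiple is equally near. *)
Lemma dist2k_up (n : int) : (0 < dist2k n)%N -> (dist2k n <= dist2k (n + 1%:Z))%N ->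
  (dist2k n < k)%N /\ exists m : int, n = m * (2 * k%:Z) + (dist2k n)%:Z.
Proof.
move=> n0 up; have [i [lek [h|h]]] := dist2kP n; last first.
  by have := dist2k_min (n + 1%:Z) i; lia.
split; last by exists i.
case: (ltnP (dist2k n) k) => // gek.
by have := dist2k_min (n + 1%:Z) (i + 1); lia.
Qed.

End Distance.

Definition upd (I : eqType) (T : Type) (g : I -> T) (e0 : I) (x : T) : I -> T :=
  fun e => if e == e0 then x else g e.

Lemma sum_upd (I : finType) (T : Type) (g : I -> T) (e0 : I) (x : T) (F : T -> nat) :
  (\sum_e F (upd g e0 x e) + F (g e0) = \sum_e F (g e) + F x)%N.
Proof.
rewrite (bigD1 e0) //= [in RHS](bigD1 e0) //= /upd eqxx.
rewrite (eq_bigr (fun e => F (g e))); last by move=> e /negPf ->.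
by lia.
Qed.

Lemma set_split (V : finType) (A : {set V}) (x : V) : x \in A -> A = [set x] \/ (1 < #|A|)%N.
Proof.
move=> xA; case: (ltnP 1 #|A|) => h; [by right|left].
have /cards1P[z Az] : #|A| == 1%N by have := cardsD1 x A; rewrite xA; lia.
by move: xA; rewrite Az inE => /eqP ->.
Qed.

(** * Orientations of a graph given by its end map *)

Section Orientations.

Variables V E : finType.
Implicit Types (g : E -> V * V) (o : E -> int) (A B : {set V}) (u v w x y : V).

Definition crossing (r : V * V) A : bool := (r.1 \in A) (+) (r.2 \in A).

Definition incidence (r : V * V) A : int := (r.1 \in A : nat)%:Z - (r.2 \in A : nat)%:Z.

Definition cutd g A : nat := (\sum_e crossing (g e) A)%N.

Definition nonloops g : nat := (\sum_e ((g e).1 != (g e).2))%N.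

(** An orientation is a sign: [o e = 1] orients [e] from [(g e).1] to [(g e).2].
    Edges are deleted by turning them into loops. *)
Definition orients o := forall e, o e = 1 \/ o e = -1.

Definition net g o A : int := \sum_e o e * incidence (g e) A.

Definition joined (r : V * V) u v : bool := (r == (u, v)) || (r == (v, u)).

Definition nonloop (r : V * V) : bool := r.1 != r.2.

Lemma joinedC r u v : joined r u v = joined r v u.
Proof. by rewrite /joined orbC. Qed.

Lemma joined_refl r : joined r r.1 r.2.
Proof. by case: r => a b; rewrite /joined eqxx. Qed.

Lemma nonloop_refl z : nonloop (z, z) = false.
Proof. by rewrite /nonloop eqxx. Qed.

Lemma crossing_joined r u v A : joined r u v -> crossing r A = (u \in A) (+) (v \in A).
Proof. by case/orP=> /eqP ->; rewrite /crossing //= addbC. Qed.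

Lemma nonloop_joined r u v : joined r u v -> nonloop r = (u != v).
Proof. by case/orP=> /eqP ->; rewrite /nonloop //= eq_sym. Qed.

Lemma incidence_joined r u v : joined r u v ->
  exists2 c : int, c = 1 \/ c = -1 &
    forall A, incidence r A = c * ((u \in A : nat)%:Z - (v \in A : nat)%:Z).
Proof.
case/orP=> /eqP ->.
  by exists 1; [left|move=> A; rewrite mul1r].
by exists (-1); [right|move=> A; rewrite /incidence /=; lia].
Qed.

Lemma cutd_upd g e0 r A :
  (cutd (upd g e0 r) A + crossing (g e0) A = cutd g A + crossing r A)%N.
Proof. exact: (sum_upd g e0 r (fun s => crossing s A : nat)). Qed.

Lemma nonloops_upd g e0 r :
  (nonloops (upd g e0 r) + nonloop (g e0) = nonloops g + nonloop r)%N.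
Proof. exact: (sum_upd g e0 r (fun s => nonloop s : nat)). Qed.

Lemma net_upd g o e0 r A :
  net (upd g e0 r) o A = net g o A + o e0 * (incidence r A - incidence (g e0) A).
Proof.
rewrite /net (bigD1 e0) //= [in RHS](bigD1 e0) //= /upd eqxx.
rewrite (eq_bigr (fun e => o e * incidence (g e) A)); last by move=> e /negPf ->.
by ring.
Qed.

Lemma net_updo g o e0 c A :
  net g (upd o e0 c) A = net g o A + (c - o e0) * incidence (g e0) A.
Proof.
rewrite /net (bigD1 e0) //= [in RHS](bigD1 e0) //= /upd eqxx.
rewrite (eq_bigr (fun e => o e * incidence (g e) A)); last by move=> e /negPf ->.
by ring.
Qed.

Lemma sum_mem (v : V) A : \sum_(u in A) (v == u : nat)%:Z = (v \in A : nat)%:Z.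
Proof.
case: (boolP (v \in A)) => vA.
  rewrite (bigD1 v) //= eqxx big1 ?addr0 // => u /andP[_ /negPf].
  by rewrite eq_sym => ->.
by rewrite big1 // => u uA; case: eqP => // vu; rewrite vu uA in vA.
Qed.

Lemma sumn_mem (v : V) A : (\sum_(u in A) (u == v) = (v \in A))%N.
Proof.
case: (boolP (v \in A)) => vA.
  by rewrite (bigD1 v) //= eqxx big1 ?addn0 // => u /andP[_ /negPf ->].
by rewrite big1 // => u uA; case: eqP => // vu; rewrite -vu uA in vA.
Qed.

Lemma orients_upd o e0 c : orients o -> c = 1 \/ c = -1 -> orients (upd o e0 c).
Proof. by move=> oo hc e; rewrite /upd; case: ifP. Qed.

Lemma incidence_loop z A : incidence (z, z) A = 0.
Proof. by rewrite /incidence /= subrr. Qed.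

Lemma crossing_loop z A : crossing (z, z) A = false.
Proof. by rewrite /crossing addbb. Qed.

Lemma net_delete g e0 x y z o : joined (g e0) x y -> orients o ->
  exists o', [/\ orients o', forall e, e != e0 -> o' e = o e &
    forall A, net g o' A =
      net (upd g e0 (z, z)) o A + ((x \in A : nat)%:Z - (y \in A : nat)%:Z)].
Proof.
move=> /incidence_joined[c c1 hc] oo; exists (upd o e0 c).
split; [exact: orients_upd|by move=> e /negPf; rewrite /upd => ->|].
move=> A; rewrite net_updo net_upd incidence_loop hc.
by case: c1 => -> ; ring.
Qed.

(** The new edge [(u, w)], stored at [e1], is replaced by the path through [x] in its direction; [c]
    and [d] correct for the order in which the ends are stored. If [e1] and [e2] are parallel and
    equally stored, a walk from [u] to [x] and back uses them with opposite signs; this will balance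
    the dummy edges. *)
Lemma net_lift g e1 e2 u x w z o :
  joined (g e1) u x -> joined (g e2) x w -> e1 != e2 -> orients o ->
  exists o', [/\ orients o', forall e, e != e1 -> e != e2 -> o' e = o e,
    (u != x -> g e1 = g e2 -> o' e1 = - o' e2) &
    forall A, net g o' A = net (upd (upd g e1 (u, w)) e2 (z, z)) o A].
Proof.
move=> /incidence_joined[c c1 hc] /incidence_joined[d d1 hd] e12 oo.
exists (upd (upd o e1 (c * o e1)) e2 (d * o e1)).
have oo1 : c * o e1 = 1 \/ c * o e1 = -1.
  by case: c1 => ->; case: (oo e1) => ->; [left|right|right|left].
have oo2 : d * o e1 = 1 \/ d * o e1 = -1.
  by case: d1 => ->; case: (oo e1) => ->; [left|right|right|left].
have e21 : (e2 == e1) = false by rewrite eq_sym (negPf e12).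
split.
- by apply: orients_upd => //; apply: orients_upd.
- by move=> e /negPf h1 /negPf h2; rewrite /upd h1 h2.
- move=> ux g12; rewrite /upd eqxx (negPf e12) eqxx -mulNr; congr (_ * _).
  have xu : x != u by rewrite eq_sym.
  have := hc [set u]; have := hc [set x]; have := hd [set u]; have := hd [set x].
  rewrite g12 !set11 !in_set1 (negPf ux) (negPf xu).
  move=> -> ->.
  by case: c1 => ->; case: d1 => ->; case: (w == _); case: (w == _).
- move=> A; rewrite !net_upd !net_updo incidence_loop.
  have -> : upd g e1 (u, w) e2 = g e2 by rewrite /upd e21.
  have -> : upd o e1 (c * o e1) e2 = o e2 by rewrite /upd e21.
  rewrite !hc !hd /incidence /=.
  by case: c1 => ->; case: d1 => ->; ring.
Qed.

Lemma cutd_lift g e1 e2 u x w z A : joined (g e1) u x -> joined (g e2) x w -> e1 != e2 ->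
  (cutd (upd (upd g e1 (u, w)) e2 (z, z)) A + ((u \in A) (+) (x \in A)) +
    ((x \in A) (+) (w \in A)) = cutd g A + ((u \in A) (+) (w \in A)))%N.
Proof.
move=> j1 j2 e12.
have := cutd_upd (upd g e1 (u, w)) e2 (z, z) A; have := cutd_upd g e1 (u, w) A.
have -> : upd g e1 (u, w) e2 = g e2 by rewrite /upd eq_sym (negPf e12).
rewrite crossing_loop (crossing_joined A j1) (crossing_joined A j2) /crossing /=.
by clear; lia.
Qed.

Lemma nonloops_lift g e1 e2 u x w z : joined (g e1) u x -> joined (g e2) x w -> e1 != e2 ->
  u != x -> w != x -> (nonloops (upd (upd g e1 (u, w)) e2 (z, z)) < nonloops g)%N.
Proof.
move=> j1 j2 e12 ux wx.
have := nonloops_upd (upd g e1 (u, w)) e2 (z, z); have := nonloops_upd g e1 (u, w).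
have -> : upd g e1 (u, w) e2 = g e2 by rewrite /upd eq_sym (negPf e12).
rewrite (nonloop_joined j1) (nonloop_joined j2) ux (eq_sym x w) wx nonloop_refl.
by case: (nonloop (u, w)) => /=; rewrite !addn1 !addn0; clear; lia.
Qed.

Variable k : nat.

Definition orientable g (W : {set V}) (b : V -> int) :=
  exists2 o, orients o & forall v, v \in W -> cong k (net g o [set v]) (b v).

Lemma orientable_delete g e0 x y z (W : {set V}) (b b' : V -> int) : joined (g e0) x y ->
  (forall v, v \in W -> b v = b' v + ((v == x : nat)%:Z - (v == y : nat)%:Z)) ->
  orientable (upd g e0 (z, z)) W b' -> orientable g W b.
Proof.
move=> j hb [o oo ho]; have [o' [oo' _ ho']] := net_delete z j oo.
exists o' => // v vW; rewrite ho' hb // !in_set1 (eq_sym x) (eq_sym y).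
by apply: congD (ho _ vW) (cong_refl _ _).
Qed.

Lemma orientable_lift g e1 e2 u x w z (W : {set V}) b :
  joined (g e1) u x -> joined (g e2) x w -> e1 != e2 ->
  orientable (upd (upd g e1 (u, w)) e2 (z, z)) W b -> orientable g W b.
Proof.
move=> j1 j2 e12 [o oo ho]; have [o' [oo' _ _ ho']] := net_lift z j1 j2 e12 oo.
by exists o' => // v vW; rewrite ho'; apply: ho.
Qed.

Lemma netN g o A : net g (fun e => - o e) A = - net g o A.
Proof. by rewrite /net -sumrN; apply: eq_bigr => e _; rewrite mulNr. Qed.

Lemma orientableN g W b : orientable g W b -> orientable g W (fun v => - b v).
Proof.
case=> o oo ho; exists (fun e => - o e).
  by move=> e; case: (oo e) => ->; [right|left; rewrite opprK].
by move=> v vW; rewrite netN; apply: congN (ho _ vW).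
Qed.

End Orientations.

Lemma big_push (R : Type) (idx : R) (op : Monoid.com_law idx) (V : finType)
    (phi : V -> V) (f : V -> R) (B : {set V}) :
  \big[op/idx]_(u in B) \big[op/idx]_(v | phi v == u) f v =
  \big[op/idx]_(v in phi @^-1: B) f v.
Proof.
rewrite [RHS](partition_big phi (mem B)) /=; last by move=> v; rewrite inE.
apply: eq_bigr => u uB; apply: eq_bigl => v.
by rewrite inE; case: eqP => [->|]; rewrite ?uB ?andbF.
Qed.

(** * Contraction *)

Section Contraction.

Variables V E : finType.
Implicit Types (g : E -> V * V) (o : E -> int) (A B W : {set V}) (a u v w x y : V).

(** The vertex type never changes: contraction and removal of vertices only shrink the set [W] of
    current vertices, and an edge that is not inside [W] has to be a loop. *)
Definition closed_ends g W := forall e, nonloop (g e) -> (g e).1 \in W /\ (g e).2 \in W.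

Definition collapse A a v : V := if v \in A then a else v.

Definition contract A a g : E -> V * V :=
  fun e => (collapse A a (g e).1, collapse A a (g e).2).

Definition inside A g e : bool := ((g e).1 \in A) && ((g e).2 \in A).

Definition inner A a g : E -> V * V := fun e => if inside A g e then g e else (a, a).

Definition push A a (f : V -> int) (u : V) : int := \sum_(v | collapse A a v == u) f v.

Definition pushn A a (f : V -> nat) (u : V) : nat := (\sum_(v | collapse A a v == u) f v)%N.

Definition outer_net A g o B : int := \sum_(e | ~~ inside A g e) o e * incidence (g e) B.

Lemma sum_push A a f B :
  \sum_(u in B) push A a f u = \sum_(v in collapse A a @^-1: B) f v.
Proof. exact: big_push. Qed.

Lemma sum_pushn A a f B :
  (\sum_(u in B) pushn A a f u = \sum_(v in collapse A a @^-1: B) f v)%N.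
Proof. exact: big_push. Qed.

Lemma incidence_contract A a g e B :
  incidence (contract A a g e) B = incidence (g e) (collapse A a @^-1: B).
Proof. by rewrite /incidence /= !inE. Qed.

Lemma crossing_contract A a g e B :
  crossing (contract A a g e) B = crossing (g e) (collapse A a @^-1: B).
Proof. by rewrite /crossing /= !inE. Qed.

Lemma cutd_contract A a g B : cutd (contract A a g) B = cutd g (collapse A a @^-1: B).
Proof. by apply: eq_bigr => e _; rewrite crossing_contract. Qed.

Lemma net_contract A a g o B : net (contract A a g) o B = net g o (collapse A a @^-1: B).
Proof. by apply: eq_bigr => e _; rewrite incidence_contract. Qed.

Lemma collapse_id A a W v : v \in a |: (W :\: A) -> collapse A a v = v.
Proof.
rewrite !inE /collapse => /orP[/eqP ->|/andP[/negPf -> _] //].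
by case: ifP.
Qed.

Lemma collapse_in A a W v : v \in W -> collapse A a v \in a |: (W :\: A).
Proof.
by move=> vW; rewrite !inE /collapse; case: ifP => [_|->]; rewrite ?eqxx ?vW ?orbT.
Qed.

Section Fixed.

Variables (A W : {set V}) (a : V).
Hypotheses (AW : A \subset W) (aA : a \in A).

Let W' := a |: (W :\: A).

Lemma contracted_sub : W' \subset W.
Proof. by rewrite subUset sub1set (subsetP AW) // subsetDl. Qed.

Lemma contracted_card : (1 < #|A|)%N -> (#|W'| < #|W|)%N.
Proof.
move=> A1; have := cardsID A W; rewrite (setIidPr AW) => <-.
rewrite cardsU1; have := leq_b1 (a \notin W :\: A); lia.
Qed.

Lemma preim_sub B : B \subset W' -> collapse A a @^-1: B \subset W.
Proof.
move=> BW; apply/subsetP => v; rewrite inE /collapse; case: ifP => [vA _|_ vB].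
  exact: (subsetP AW).
exact: (subsetP contracted_sub _ (subsetP BW _ vB)).
Qed.

Lemma mem_preim B v : B \subset W' -> v \in B -> v \in collapse A a @^-1: B.
Proof. by move=> BW vB; rewrite inE (collapse_id (subsetP BW _ vB)). Qed.

Lemma preimT : collapse A a @^-1: W' = W.
Proof.
apply/eqP; rewrite eqEsubset preim_sub //=; apply/subsetP => v vW.
by rewrite inE collapse_in.
Qed.

Lemma preim0 B : B \subset W' -> B != set0 -> collapse A a @^-1: B != set0.
Proof.
by move=> BW /set0Pn[v vB]; apply/set0Pn; exists v; apply: mem_preim.
Qed.

Lemma preim_neqT B : B \subset W' -> B != W' -> collapse A a @^-1: B != W.
Proof.
move=> BW; apply: contra => /eqP h; rewrite eqEsubset BW /=.
apply/subsetP => v vW'; have vW := subsetP contracted_sub _ vW'.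
by move: vW; rewrite -h inE (collapse_id vW').
Qed.

Lemma preim1_notin x : x \in W' -> x \notin A -> collapse A a @^-1: [set x] = [set x].
Proof.
move=> xW xA; apply/setP => v; rewrite !inE /collapse; case: ifP => // vA.
by apply/eqP/eqP => h; [move: xA; rewrite -h aA|move: xA; rewrite -h vA].
Qed.

Lemma preim1_in : collapse A a @^-1: [set a] = A.
Proof.
apply/setP => v; rewrite !inE /collapse; case: (boolP (v \in A)) => vA; first by rewrite eqxx.
by apply/eqP => h; move: vA; rewrite h aA.
Qed.

Lemma preimD1 x : x \notin A ->
  collapse A a @^-1: (W' :\ x) = W :\ x.
Proof.
move=> xA; apply/setP => v; rewrite !inE /collapse; case: ifP => vA.
  rewrite eqxx /= andbT (subsetP AW) // andbT.
  have -> : (a == x) = false by apply/eqP => h; move: xA; rewrite -h aA.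
  by have -> : (v == x) = false by apply/eqP => h; move: xA; rewrite -h vA.
rewrite vA /=; case: (v =P a) => [h|_]; last by [].
by move: vA; rewrite h aA.
Qed.

Lemma preim_inj (B C : {set V}) : B \subset W' -> C \subset W' ->
  collapse A a @^-1: B = collapse A a @^-1: C -> B = C.
Proof.
move=> BW CW h; apply/setP => v; apply/idP/idP => vB.
  have := mem_preim BW vB; rewrite h inE.
  by rewrite (collapse_id (subsetP BW _ vB)).
have := mem_preim CW vB; rewrite -h inE.
by rewrite (collapse_id (subsetP CW _ vB)).
Qed.

Lemma preim_block B v : v \in A -> (v \in collapse A a @^-1: B) = (a \in B).
Proof. by move=> vA; rewrite inE /collapse vA. Qed.

Lemma closed_contract g : closed_ends g W -> closed_ends (contract A a g) W'.
Proof.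
move=> gW e; rewrite /nonloop /= => h.
have /gW[h1 h2] : nonloop (g e) by apply: contraNN h => /eqP ->.
by split; apply: collapse_in.
Qed.

Lemma closed_inner g : closed_ends (inner A a g) A.
Proof.
move=> e; rewrite /inner; case: ifP => [/andP[h1 h2] //|_].
by rewrite /nonloop eqxx.
Qed.

Lemma net_inner g o B : net g o B = net (inner A a g) o B + outer_net A g o B.
Proof.
rewrite /net /outer_net (bigID (inside A g)) /= [X in _ = X + _](bigID (inside A g)) /=.
rewrite [X in _ = _ + X + _]big1 ?addr0 /=; last first.
  by move=> e /negPf h; rewrite /inner h incidence_loop mulr0.
by congr (_ + _); apply: eq_bigr => e h; rewrite /inner h.
Qed.

Lemma cutd_inner g B :
  cutd g B = (cutd (inner A a g) B + \sum_(e | ~~ inside A g e) crossing (g e) B)%N.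
Proof.
rewrite /cutd (bigID (inside A g)) /= [X in _ = (X + _)%N](bigID (inside A g)) /=.
rewrite [X in _ = (_ + X + _)%N]big1 ?addn0 /=; last first.
  by move=> e /negPf h; rewrite /inner h crossing_loop.
by congr (_ + _)%N; apply: eq_bigr => e h; rewrite /inner h.
Qed.

(** The edges leaving [A] are oriented first, with [A] contracted to [a]; they
    shift the prescription for the edges inside [A]. *)
Lemma orientable_compose k g (b : V -> int) :
  orientable k (contract A a g) W' (push A a b) ->
  (forall o, orients o -> cong k (outer_net A g o A) (\sum_(v in A) b v) ->
     orientable k (inner A a g) A (fun v => b v - outer_net A g o [set v])) ->
  orientable k g W b.
Proof.
case=> o1 oo1 h1 h2.
have inA o : net (inner A a g) o A = 0.
  rewrite /net big1 // => e _; rewrite /inner /inside; case: ifP => [/andP[i j]|_].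
    by rewrite /incidence i j subrr mulr0.
  by rewrite incidence_loop mulr0.
have outA : cong k (outer_net A g o1 A) (\sum_(v in A) b v).
  have := h1 a; rewrite !inE eqxx => /(_ isT).
  rewrite net_contract preim1_in net_inner inA add0r /push => h.
  congr (cong _ _ _): h; apply: eq_bigl => v.
  by have /setP/(_ v) := preim1_in; rewrite !inE => ->.
have [o2 oo2 h3] := h2 _ oo1 outA.
pose o e := if inside A g e then o2 e else o1 e.
exists o; first by move=> e; rewrite /o; case: ifP.
have outE B : outer_net A g o B = outer_net A g o1 B.
  by apply: eq_bigr => e /negPf h; rewrite /o h.
have innE B : net (inner A a g) o B = net (inner A a g) o2 B.
  apply: eq_bigr => e _; rewrite /o /inner; case: ifP => // _.
  by rewrite incidence_loop !mulr0.
move=> v vW; rewrite net_inner outE innE.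
case: (boolP (v \in A)) => vA.
  have := congD (h3 _ vA) (cong_refl k (outer_net A g o1 [set v])).
  by rewrite subrK.
have -> : net (inner A a g) o2 [set v] = 0.
  rewrite /net big1 // => e _; rewrite /inner; case: ifP => [/andP[i j]|_].
    rewrite /incidence !in_set1.
    have -> : ((g e).1 == v) = false by apply/eqP => h; move: vA; rewrite -h i.
    have -> : ((g e).2 == v) = false by apply/eqP => h; move: vA; rewrite -h j.
    by rewrite subrr mulr0.
  by rewrite incidence_loop mulr0.
have vW' : v \in W' by rewrite !inE vA vW orbT.
have := h1 _ vW'.
rewrite net_contract (preim1_notin vW' vA) net_inner.
have -> : net (inner A a g) o1 [set v] = 0.
  rewrite /net big1 // => e _; rewrite /inner; case: ifP => [/andP[i j]|_].
    rewrite /incidence !in_set1.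
    have -> : ((g e).1 == v) = false by apply/eqP => h; move: vA; rewrite -h i.
    have -> : ((g e).2 == v) = false by apply/eqP => h; move: vA; rewrite -h j.
    by rewrite subrr mulr0.
  by rewrite incidence_loop mulr0.
suff -> : push A a b v = b v by [].
rewrite /push (big_pred1 v) // => u.
by have /setP/(_ u) := preim1_notin vW' vA; rewrite !inE.
Qed.

End Fixed.

End Contraction.

(** * Extending an orientation given at one vertex *)

Section Admissible.

Variables (V E : finType) (k : nat).
Hypothesis k_gt1 : (1 < k)%N.

Implicit Types (g : E -> V * V) (o : E -> int) (A B W : {set V}) (a u v w x y : V).
Implicit Types (b : V -> int) (p q : V -> nat) (ex : option V).

(** The extra vertex z0 lies outside [W] and its edges do not appear in [g]:
    [p v] of them are oriented from z0 to [v], and [q v] from [v] to z0.  While [b]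
    prescribes the net out-degree over the edges of [g] only, [beta] and [bnd] also
    count the edges at z0. *)
Definition load p q A : nat := (\sum_(v in A) (p v + q v))%N.

Definition bnd g p q A : nat := (cutd g A + load p q A)%N.

Definition beta b p q A : int := \sum_(v in A) (b v + (q v)%:Z - (p v)%:Z).

Definition demand b p q A : nat := (2 * k - 2 + dist2k k (beta b p q A))%N.

Definition exempt ex W A : bool := if ex is Some x then (A == [set x]) || (A == W :\ x) else false.

(** The cut condition is waived for an exempt vertex [x] with prescription 0, and
    for its complement: such an [x] will be split off completely, which needs at
    most half of its edges to go to z0. *)
Record admissible g W b p q ex : Prop := Admissible {
  adm_ends : closed_ends g W;
  adm_par : forall A, A \subset W -> exists m : int, beta b p q A = (bnd g p q A)%:Z + 2 * m;
  adm_sum : cong k (\sum_(v in W) b v) 0;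
  adm_cut : forall A, A \subset W -> A != set0 -> A != W -> ~~ exempt ex W A ->
    (demand b p q A <= bnd g p q A)%N;
  adm_out : (bnd g p q W <= demand b p q W)%N;
  adm_ex : forall x, ex = Some x -> [/\ x \in W, cong k (beta b p q [set x]) 0 &
    (2 * load p q [set x] <= bnd g p q [set x])%N] }.

Section Contract.

Variables (g : E -> V * V) (b : V -> int) (p q : V -> nat) (A W : {set V}) (a : V).
Hypotheses (AW : A \subset W) (aA : a \in A) (A1 : (1 < #|A|)%N).

Let W' := a |: (W :\: A).

Lemma bnd_contract B :
  bnd (contract A a g) (pushn A a p) (pushn A a q) B = bnd g p q (collapse A a @^-1: B).
Proof.
rewrite /bnd cutd_contract; congr (_ + _)%N; rewrite /load -sum_pushn.
by apply: eq_bigr => u _; rewrite /pushn big_split.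
Qed.

Lemma load_contract B :
  load (pushn A a p) (pushn A a q) B = load p q (collapse A a @^-1: B).
Proof.
rewrite /load -sum_pushn.
by apply: eq_bigr => u _; rewrite /pushn big_split.
Qed.

Lemma beta_contract B :
  beta (push A a b) (pushn A a p) (pushn A a q) B = beta b p q (collapse A a @^-1: B).
Proof.
rewrite /beta -sum_push; apply: eq_bigr => u _.
rewrite /push /pushn !sumrB big_split /=.
by rewrite !(big_morph _ PoszD (erefl _)).
Qed.

Lemma admissible_contract ex : admissible g W b p q ex ->
  admissible (contract A a g) W' (push A a b) (pushn A a p) (pushn A a q)
    (if ex is Some x then if x \in A then None else ex else None).
Proof.
case=> h1 h2 h3 h4 h5 h6; split.
- exact: closed_contract.
- by move=> B BW; rewrite beta_contract bnd_contract; apply/h2/preim_sub.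
- by rewrite sum_push preimT.
- move=> B BW B0 BT hB; rewrite /demand beta_contract bnd_contract.
  apply: h4; [exact: preim_sub|exact: (preim0 BW)|exact: (preim_neqT AW aA BW BT)|].
  case: ex h6 hB => [x|] //= h6; have [xW _ _] := h6 _ erefl.
  case: ifP => xA.
    have /card_gt0P[y] : (0 < #|A :\ x|)%N by have := cardsD1 x A; rewrite xA; lia.
    rewrite !inE => /andP[yx yA] _.
    have := preim_block a B xA; rewrite -(preim_block a B yA) => hxy.
    apply/negP => /orP[/eqP h|/eqP h]; move: hxy; rewrite h.
      by rewrite !in_set1 eqxx (negPf yx).
    by rewrite !in_setD1 eqxx yx (subsetP AW _ yA).
  apply: contra => /= /orP[/eqP h|/eqP h].
    have xW' : x \in W' by rewrite !inE xA xW orbT.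
    apply/orP; left; apply/eqP; apply: (preim_inj BW); first by rewrite sub1set.
    by rewrite h (preim1_notin aA xW') ?xA.
  apply/orP; right; apply/eqP; apply: (preim_inj BW); first exact: subsetDl.
  by rewrite h preimD1 ?xA.
- by rewrite /demand beta_contract bnd_contract preimT.
- move=> x; case: ex {h4} h6 => [y|] //; case: ifP => // yA h6 [<-].
  have [yW c1 c2] := h6 _ erefl.
  have yW' : y \in W' by rewrite !inE yA yW orbT.
  rewrite beta_contract bnd_contract load_contract.
  by rewrite !(preim1_notin aA yW') ?yA.
Qed.

Section Inner.

Variable o : E -> int.
Hypothesis oo : orients o.

Definition out_at v e : bool := o e * incidence (g e) [set v] == 1.

Definition in_at v e : bool := o e * incidence (g e) [set v] == -1.

(** With everything outside [A] shrunk to z0, an outer edge leaving [v] becomes an edge from [v] to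
    z0; hence [tailsn] is added to [q], and [headsn] to [p]. *)
Definition tailsn v : nat := (\sum_(e | ~~ inside A g e) out_at v e)%N.
Definition headsn v : nat := (\sum_(e | ~~ inside A g e) in_at v e)%N.

Let b2 v := b v - outer_net A g o [set v].
Let p2 v := (p v + headsn v)%N.
Let q2 v := (q v + tailsn v)%N.

Lemma outer_incidence e v : v \in A -> ~~ inside A g e ->
  (out_at v e + in_at v e =
    (((g e).1 == v) + ((g e).2 == v)))%N /\
  (out_at v e : nat)%:Z -
    (in_at v e : nat)%:Z = o e * incidence (g e) [set v].
Proof.
rewrite /out_at /in_at /inside /incidence !in_set1 => vA.
case: ((g e).1 =P v) => [->|_]; case: ((g e).2 =P v) => [->|_]; rewrite ?vA //=;
  by case: (oo e) => ->.
Qed.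

(** An outer edge with an end in [B] has its other end outside [A], so it crosses [B]; it merely
    moves from [cutd] to [load]. *)
Lemma bnd_inner B : B \subset A -> bnd (inner A a g) p2 q2 B = bnd g p q B.
Proof.
move=> BA; rewrite /bnd (cutd_inner A a g B) -addnA; congr (_ + _)%N.
rewrite /load /p2 /q2.
rewrite (eq_bigr (fun v => (p v + q v) + (tailsn v + headsn v))%N); last by move=> v _; lia.
rewrite big_split /= addnC; congr (_ + _)%N.
rewrite /tailsn /headsn.
under eq_bigr => v vB do rewrite -big_split /=.
rewrite exchange_big; apply: eq_bigr => e eA.
rewrite (eq_bigr (fun v => (v == (g e).1) + (v == (g e).2))%N); last first.
  move=> v vB; have [-> _] := outer_incidence (subsetP BA _ vB) eA.
  by rewrite !(eq_sym v).
rewrite big_split /= !sumn_mem /crossing.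
move: eA; rewrite /inside.
by case: (boolP ((g e).1 \in B)) => [/(subsetP BA) ->|_];
  case: (boolP ((g e).2 \in B)) => [/(subsetP BA) ->|_].
Qed.

Lemma beta_inner B : B \subset A -> beta b2 p2 q2 B = beta b p q B.
Proof.
move=> BA; apply: eq_bigr => v /(subsetP BA) vA; rewrite /b2 /p2 /q2 !PoszD.
suff : outer_net A g o [set v] = (tailsn v)%:Z - (headsn v)%:Z by lia.
rewrite /tailsn /headsn !(big_morph _ PoszD (erefl _)) -sumrB.
by apply: eq_bigr => e eA; have [_ ->] := outer_incidence vA eA.
Qed.

(** [beta] and [bnd] are unchanged on subsets of [A], so the conditions carry over. No inner edge
    leaves [A]; thus the last hypothesis bounds the load of [A] by the inner cut of [x] plus the
    load of [A :\ x], which says that at most half of the edges at [x] go to z0. *)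
Lemma admissible_inner ex :
  cong k (outer_net A g o A) (\sum_(v in A) b v) ->
  (forall B, B \subset W -> exists m : int, beta b p q B = (bnd g p q B)%:Z + 2 * m) ->
  (bnd g p q A <= demand b p q A)%N ->
  (forall B, B \subset A -> B != set0 -> B != A -> ~~ exempt ex A B ->
    (demand b p q B <= bnd g p q B)%N) ->
  (forall x, ex = Some x -> [/\ x \in A, cong k (beta b p q [set x]) 0 &
    (bnd g p q A <= bnd g p q (A :\ x))%N]) ->
  admissible (inner A a g) A b2 p2 q2 ex.
Proof.
move=> h1 h2 h3 h4 h5; split.
- exact: closed_inner.
- move=> B BA; rewrite beta_inner // bnd_inner //.
  by apply: h2; apply: subset_trans AW.
- rewrite /b2 sumrB.
  have -> : \sum_(v in A) outer_net A g o [set v] = outer_net A g o A.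
    rewrite /outer_net exchange_big; apply: eq_bigr => e _; rewrite -mulr_sumr.
    congr (_ * _); rewrite /incidence sumrB -!sum_mem.
    by congr (_ - _); apply: eq_bigr => u _; rewrite in_set1.
  have := congD (cong_refl k (\sum_(v in A) b v)) (congN h1); rewrite subrr.
  exact.
- by move=> B BA B0 BT Bex; rewrite /demand beta_inner // bnd_inner //; apply: h4.
- by rewrite /demand beta_inner // bnd_inner.
- move=> x /h5[xA cx le]; rewrite beta_inner ?sub1set //; split=> //.
  move: le; rewrite -bnd_inner // -[in X in (_ <= X)%N -> _]bnd_inner ?subsetDl //.
  rewrite /bnd.
  have -> : cutd (inner A a g) A = 0%N.
    rewrite /cutd big1 // => e _; rewrite /inner /inside; case: ifP => [/andP[i j]|_].
      by rewrite /crossing i j.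
    by rewrite crossing_loop.
  have -> : cutd (inner A a g) (A :\ x) = cutd (inner A a g) [set x].
    apply: eq_bigr => e _; rewrite /inner /inside; case: ifP => [/andP[i j]|_].
      by rewrite /crossing !in_setD1 i j !in_set1 !andbT; do 2 case: (_ == x).
    by rewrite !crossing_loop.
  have -> : load p2 q2 A = (load p2 q2 [set x] + load p2 q2 (A :\ x))%N.
    rewrite /load big_set1 (big_setD1 x) //=.
  by lia.
Qed.

End Inner.

End Contract.
End Admissible.

(** * Elementary moves preserving admissibility *)

Section Moves.

Variables (V E : finType) (k : nat).

Implicit Types (g : E -> V * V) (o : E -> int) (A B W : {set V}) (a u v w x y : V).
Implicit Types (b : V -> int) (p q : V -> nat) (ex : option V).

Lemma bnd_upd g p q e0 r A :
  (bnd (upd g e0 r) p q A + crossing (g e0) A = bnd g p q A + crossing r A)%N.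
Proof. by have := cutd_upd g e0 r A; rewrite /bnd; lia. Qed.

Lemma load_change p q p' q' x y (i j : nat) A :
  (forall v, p' v + q' v + i * (v == x) = p v + q v + j * (v == y))%N ->
  (load p' q' A + i * (x \in A) = load p q A + j * (y \in A))%N.
Proof.
move=> h; rewrite /load -!sumn_mem !big_distrr /= -!big_split.
by apply: eq_bigr => v _; apply: h.
Qed.

Lemma sum_indicator (c : int) x A : \sum_(v in A) c * (v == x : nat)%:Z = c * (x \in A : nat)%:Z.
Proof.
rewrite -mulr_sumr -sum_mem; congr (_ * _); apply: eq_bigr => v _.
by rewrite eq_sym.
Qed.

Lemma beta_change b p q b' p' q' x y (i j : int) A :
  (forall v, b' v + (q' v)%:Z - (p' v)%:Z = b v + (q v)%:Z - (p v)%:Z +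
    i * (v == x : nat)%:Z + j * (v == y : nat)%:Z) ->
  beta b' p' q' A = beta b p q A + i * (x \in A : nat)%:Z + j * (y \in A : nat)%:Z.
Proof.
move=> h; rewrite /beta -!sum_indicator -!big_split.
by apply: eq_bigr => v _; apply: h.
Qed.

Lemma sum_change b b' x y (i j : int) A :
  (forall v, b' v = b v + i * (v == x : nat)%:Z + j * (v == y : nat)%:Z) ->
  \sum_(v in A) b' v = \sum_(v in A) b v + i * (x \in A : nat)%:Z + j * (y \in A : nat)%:Z.
Proof.
move=> h; rewrite -!sum_indicator -!big_split.
by apply: eq_bigr => v _; apply: h.
Qed.

(** Slack two, which by parity is what a strict inequality provides, absorbs one deletion or one
    lifting. A set violating this is tight and can be contracted. *)
Definition spacious g W b p q ex := forall A, A \subset W -> (1 < #|A|)%N -> A != W ->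
  ~~ exempt ex W A -> (demand k b p q A + 2 <= bnd g p q A)%N.

(** Whether an edge at [x] may be deleted after being oriented away from [x]: the loss of one edge
    has to be paid for by spare edges or by a smaller distance. [can_absorb] is the counterpart for
    incoming edges. *)
Definition can_emit g b p q x : bool :=
  (demand k b p q [set x] < bnd g p q [set x])%N ||
  (dist2k k (beta b p q [set x] - 1%:Z) < dist2k k (beta b p q [set x]))%N.

Definition can_absorb g b p q x : bool :=
  (demand k b p q [set x] < bnd g p q [set x])%N ||
  (dist2k k (beta b p q [set x] + 1%:Z) < dist2k k (beta b p q [set x]))%N.

Lemma betaN b p q A : beta (fun v => - b v) q p A = - beta b p q A.
Proof. by rewrite /beta -sumrN; apply: eq_bigr => v _; lia. Qed.

Lemma loadC p q A : load q p A = load p q A.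
Proof. by apply: eq_bigr => v _; rewrite addnC. Qed.

Hypothesis k_gt1 : (1 < k)%N.

Lemma demand_gap g b p q A :
  (exists m : int, beta b p q A = (bnd g p q A)%:Z + 2 * m) ->
  (demand k b p q A < bnd g p q A)%N -> (demand k b p q A + 2 <= bnd g p q A)%N.
Proof.
case=> m hm; have [i hi] := dist2k_par k_gt1 (beta b p q A).
by move: hm hi; rewrite /demand; lia.
Qed.

Section Fixed.

Variables (g : E -> V * V) (W : {set V}) (b : V -> int) (p q : V -> nat).

(** Moving an edge away changes [bnd] by 1 and [dist2k] by at most 1, so only
    singletons can lose feasibility once all other sets are [spacious]. *)
Lemma admissible_remove x q' :
  admissible k g W b p q None -> spacious g W b p q None -> x \in W ->
  can_emit g b p q x -> (forall v, q v = q' v + (v == x))%N ->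
  admissible k g W b p q' None.
Proof.
move=> [h1 h2 h3 h4 h5 h6] sp xW xOK hq.
have Dq A : (bnd g p q' A + (x \in A) = bnd g p q A)%N.
  have := @load_change p q p q' x x 1 0 A; rewrite mul1n mul0n addn0 /bnd => <-; first by lia.
  by move=> v; rewrite hq; lia.
have Bq A : beta b p q' A = beta b p q A - (x \in A : nat)%:Z.
  rewrite (@beta_change b p q b p q' x x (-1) 0 A); first by lia.
  by move=> v; rewrite (hq v); lia.
have step A := dist2k_dec k_gt1 (beta b p q A).
split=> //.
- by move=> A AW; have [m hm] := h2 _ AW; rewrite Bq hm -Dq; exists m; clear; lia.
- move=> A AW A0 AT _; have := h4 A AW A0 AT isT; have := Dq A; rewrite /demand Bq.
  case: (boolP (x \in A)) => xA /=; last by rewrite subr0; clear; lia.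
  have [Ax|A2] := set_split xA.
    subst A; move: xOK => /orP[/(demand_gap (h2 _ AW))|].
      by rewrite /demand; have := step [set x]; clear; lia.
    by clear; lia.
  by have := sp _ AW A2 AT isT; rewrite /demand; have := step A; clear; lia.
- have := Dq W; move: h5; rewrite /demand Bq xW /=.
  by have := step W; clear; lia.
Qed.

Lemma admissible_delete e0 x y b' :
  admissible k g W b p q None -> spacious g W b p q None ->
  joined (g e0) x y -> x != y -> can_emit g b p q x -> can_absorb g b p q y ->
  (forall v, b' v = b v + (-1) * (v == x : nat)%:Z + 1 * (v == y : nat)%:Z) ->
  admissible k (upd g e0 (x, x)) W b' p q None.
Proof.
move=> [h1 h2 h3 h4 h5 h6] sp j xy xOK yOK hb.
have /h1 : nonloop (g e0) by rewrite (nonloop_joined j).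
have -> : (g e0).1 \in W /\ (g e0).2 \in W <-> x \in W /\ y \in W.
  by case/orP: j => /eqP -> /=; tauto.
case=> xW yW.
have Dg A : (bnd (upd g e0 (x, x)) p q A + ((x \in A) (+) (y \in A)) = bnd g p q A)%N.
  by have := bnd_upd g p q e0 (x, x) A; rewrite crossing_loop (crossing_joined A j); clear; lia.
have Bb A : beta b' p q A = beta b p q A - (x \in A : nat)%:Z + (y \in A : nat)%:Z.
  rewrite (@beta_change b p q b' p q x y (-1) 1 A); first by lia.
  by move=> v; rewrite (hb v); lia.
have step1 A := dist2k_dec k_gt1 (beta b p q A).
have step2 A := dist2k_inc k_gt1 (beta b p q A).
split=> //.
- by move=> e; rewrite /upd; case: ifP => [_|_ /h1//]; rewrite /nonloop eqxx.
- move=> A AW; have [m hm] := h2 _ AW; rewrite Bb hm -Dg.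
  case: (x \in A); case: (y \in A) => /=.
  + by exists m; clear; lia.
  + by exists m; clear; lia.
  + by exists (m + 1); clear; lia.
  + by exists m; clear; lia.
- by rewrite (sum_change W hb) xW yW /= mulr1 mul1r subrK.
- move=> A AW A0 AT _; have := h4 A AW A0 AT isT; have := Dg A; rewrite /demand Bb.
  case: (boolP (x \in A)) => xA; case: (boolP (y \in A)) => yA /=.
  + by rewrite subrK; clear; lia.
  + rewrite addr0; have [Ax|A2] := set_split xA.
      subst A; move: xOK => /orP[/(demand_gap (h2 _ AW))|].
        by rewrite /demand; have := step1 [set x]; clear; lia.
      by clear; lia.
    by have := sp _ AW A2 AT isT; rewrite /demand; have := step1 A; clear; lia.
  + rewrite subr0; have [Ay|A2] := set_split yA.
      subst A; move: yOK => /orP[/(demand_gap (h2 _ AW))|].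
        by rewrite /demand; have := step2 [set y]; clear; lia.
      by clear; lia.
    by have := sp _ AW A2 AT isT; rewrite /demand; have := step2 A; clear; lia.
  + by rewrite subr0 addr0; clear; lia.
- by have := Dg W; move: h5; rewrite /demand Bb xW yW /= subrK; clear; lia.
Qed.

(** On sets containing [y], [bnd] grows by [j] and the distance by at most [j]. Only the upper bound
    [adm_out] can break, so it is assumed. *)
Lemma admissible_add y j q' :
  admissible k g W b p q None -> spacious g W b p q None -> y \in W ->
  (forall v, q' v = q v + j * (v == y))%N ->
  (bnd g p q' W <= demand k b p q' W)%N ->
  admissible k g W b p q' None /\ spacious g W b p q' None.
Proof.
move=> [h1 h2 h3 h4 h5 h6] sp yW hq out.
have Dq A : (bnd g p q' A = bnd g p q A + j * (y \in A))%N.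
  rewrite /bnd -addnA -(@load_change p q p q' y y 0 j A) ?mul0n ?addn0 //.
  by move=> v; rewrite hq; lia.
have Bq A : beta b p q' A = beta b p q A + (j * (y \in A))%N%:Z.
  rewrite (@beta_change b p q b p q' y y j 0 A); first lia.
  by move=> v; rewrite (hq v); lia.
have gain A : (demand k b p q' A + bnd g p q A <= bnd g p q' A + demand k b p q A)%N.
  rewrite Dq /demand Bq.
  by have := dist2k_lip k_gt1 (beta b p q A) (j * (y \in A))%N; lia.
split=> //.
- split=> //.
  + move=> A AW; have [m hm] := h2 _ AW; rewrite Bq Dq hm; exists m; lia.
  + by move=> A AW A0 AT _; have := h4 A AW A0 AT isT; have := gain A; lia.
- by move=> A AW A2 AT _; have := sp A AW A2 AT isT; have := gain A; lia.
Qed.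

End Fixed.

(** Reversing all edges exchanges [p] and [q]; results on emitting vertices thereby yield those on
    absorbing ones. *)
Lemma admissibleN g W b p q ex : admissible k g W b p q ex ->
  admissible k g W (fun v => - b v) q p ex.
Proof.
case=> h1 h2 h3 h4 h5 h6.
have Dq A : bnd g q p A = bnd g p q A by rewrite /bnd loadC.
have dq A : demand k (fun v => - b v) q p A = demand k b p q A.
  by rewrite /demand betaN dist2kN.
split=> //.
- move=> A AW; have [m hm] := h2 _ AW; rewrite betaN Dq hm.
  by exists (- m - (bnd g p q A)%:Z); lia.
- by rewrite sumrN; have := congN h3; rewrite oppr0.
- by move=> A AW A0 AT Aex; rewrite dq Dq; apply: h4.
- by rewrite dq Dq.
- move=> x /h6[xW cx lx]; split=> //; last by rewrite loadC Dq.
  by rewrite betaN; have := congN cx; rewrite oppr0.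
Qed.

Lemma spaciousN g W b p q ex : spacious g W b p q ex ->
  spacious g W (fun v => - b v) q p ex.
Proof.
move=> sp A AW A2 AT Aex; have := sp A AW A2 AT Aex.
by rewrite /demand betaN dist2kN // /bnd loadC.
Qed.

Lemma can_emitN g b p q x : can_emit g (fun v => - b v) q p x = can_absorb g b p q x.
Proof.
rewrite /can_emit /can_absorb /demand betaN /bnd loadC.
have -> n : dist2k k (- n - 1%:Z) = dist2k k (n + 1%:Z).
  by rewrite -opprD; apply: dist2kN.
by rewrite (dist2kN k_gt1 (beta b p q [set x])).
Qed.

Lemma can_absorbN g b p q x : can_absorb g (fun v => - b v) q p x = can_emit g b p q x.
Proof.
rewrite /can_emit /can_absorb /demand betaN /bnd loadC.
have -> n : dist2k k (- n + 1%:Z) = dist2k k (n - 1%:Z).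
  by rewrite -(dist2kN k_gt1 (n - 1%:Z)) opprB addrC.
by rewrite (dist2kN k_gt1 (beta b p q [set x])).
Qed.

End Moves.

(** * Contracting tight sets, and lifting edges at an exempt vertex *)

Section Extension.

Variables (V E : finType) (k : nat).

Implicit Types (g : E -> V * V) (o : E -> int) (A B W : {set V}) (a u v w x y : V).
Implicit Types (b : V -> int) (p q : V -> nat) (ex : option V).

Lemma crossing1P r x : crossing r [set x] -> exists2 u, u != x & joined r x u.
Proof.
rewrite /crossing !in_set1; case: r => [c d] /=.
case: (c =P x) => [->|/eqP cx]; case: (d =P x) => [->|/eqP dx] //= _.
  by exists d; rewrite // /joined eqxx.
by exists c; rewrite // /joined eqxx orbT.
Qed.

Lemma cutd_gt0 g A : (0 < cutd g A)%N -> exists e, crossing (g e) A.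
Proof.
move=> h; apply/existsP; apply: contraTT h; rewrite negb_exists => /forallP h.
by rewrite /cutd big1 // => e _; rewrite (negPf (h e)).
Qed.

Lemma cutd_gt1 g A e1 : (1 < cutd g A)%N -> exists2 e, e != e1 & crossing (g e) A.
Proof.
move=> h; suff /existsP[e /andP[h1 h2]] : [exists e, (e != e1) && crossing (g e) A].
  by exists e.
apply: contraTT h; rewrite negb_exists => /forallP h.
rewrite -leqNgt /cutd (bigD1 e1) //= big1 ?addn0 ?leq_b1 // => e ee1.
by have := h e; rewrite ee1 /= => /negPf ->.
Qed.

Lemma joined_in g W e x y : closed_ends g W -> joined (g e) x y -> x != y ->
  x \in W /\ y \in W.
Proof.
move=> gW j xy; have /gW : nonloop (g e) by rewrite (nonloop_joined j).
by case/orP: j => /eqP -> /= [].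
Qed.

Lemma beta1 b p q x : beta b p q [set x] = b x + (q x)%:Z - (p x)%:Z.
Proof. by rewrite /beta big_set1. Qed.

Lemma load1 p q x : load p q [set x] = (p x + q x)%N.
Proof. by rewrite /load big_set1. Qed.

Lemma betaD1 b p q A x : x \in A ->
  beta b p q A = beta b p q [set x] + beta b p q (A :\ x).
Proof. by move=> xA; rewrite /beta (big_setD1 x xA) big_set1. Qed.

Lemma loadD1 p q A x : x \in A -> load p q A = (load p q [set x] + load p q (A :\ x))%N.
Proof. by move=> xA; rewrite /load (big_setD1 x xA) big_set1. Qed.

Lemma cutdC g W A : closed_ends g W -> cutd g (W :\: A) = cutd g A.
Proof.
move=> gW; apply: eq_bigr => e _; rewrite /crossing !inE.
case: (boolP (nonloop (g e))) => [/gW[-> ->]|].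
  by rewrite !andbT; do 2 case: (_ \in A).
by rewrite negbK => /eqP ->; rewrite !addbb.
Qed.

Lemma cutdD1 g W x : closed_ends g W -> cutd g (W :\ x) = cutd g [set x].
Proof. exact: cutdC. Qed.

Lemma cutdT g W : closed_ends g W -> cutd g W = 0%N.
Proof.
move=> gW; rewrite /cutd big1 // => e _; rewrite /crossing.
case: (boolP (nonloop (g e))) => [/gW[-> ->] //|].
by rewrite negbK => /eqP ->; rewrite addbb.
Qed.

Lemma closed_ends_drop g W x : closed_ends g W -> cutd g [set x] = 0%N ->
  closed_ends g (W :\ x).
Proof.
move=> gW gx e ne; have [i j] := gW _ ne; rewrite !in_setD1 i j !andbT.
have : crossing (g e) [set x] = false.
  by apply/negP => c; move: gx; rewrite /cutd (bigD1 e) //= c.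
rewrite /crossing !in_set1; move: ne; rewrite /nonloop.
by case: ((g e).1 =P x) => [->|]; case: ((g e).2 =P x) => [->|]; rewrite ?eqxx.
Qed.

Lemma orientable_ext g W b b' : (forall v, v \in W -> b v = b' v) ->
  orientable k g W b -> orientable k g W b'.
Proof. by move=> h [o oo ho]; exists o => // v vW; rewrite -h //; apply: ho. Qed.

Lemma orientableNN g W b : orientable k g W (fun v => - b v) -> orientable k g W b.
Proof.
by move=> /orientableN; apply: orientable_ext => v _; rewrite opprK.
Qed.

Lemma orientable_small g W b p q ex : (#|W| <= 1)%N -> admissible k g W b p q ex ->
  orientable k g W b.
Proof.
move=> W1 [h1 _ h3 _ _ _]; exists (fun=> 1); first by move=> _; left.
move=> v vW; have [Wv|] := set_split vW; last by rewrite ltnNge W1.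
have -> : net g (fun=> 1) [set v] = 0.
  rewrite /net big1 // => e _; rewrite /incidence -Wv.
  case: (boolP (nonloop (g e))) => [/h1[-> ->]|]; first by rewrite subrr mulr0.
  by rewrite negbK => /eqP ->; rewrite subrr mulr0.
by apply: cong_sym; move: h3; rewrite Wv big_set1.
Qed.

Hypothesis k_gt1 : (1 < k)%N.

Lemma spaciousPn g W b p q ex : admissible k g W b p q ex ->
  spacious k g W b p q ex \/
  exists A, [/\ A \subset W, (1 < #|A|)%N, A != W, ~~ exempt ex W A &
    (bnd g p q A <= demand k b p q A)%N].
Proof.
move=> adm.
case: (boolP [exists A : {set V}, [&& A \subset W, (1 < #|A|)%N, A != W, ~~ exempt ex W A &
    (bnd g p q A <= demand k b p q A)%N]]) => [/existsP[A /and5P[? ? ? ? ?]]|].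
  by right; exists A; split.
rewrite negb_exists => /forallP h; left => A AW A1 AT Aex.
have := h A; rewrite AW A1 AT Aex /= -ltnNge; apply: demand_gap => //.
exact: adm_par adm _ AW.
Qed.

(** Both the contraction and the inside of [A] have fewer vertices than [W]. An exempt vertex stays
    exempt in exactly one of the two. *)
Lemma orientable_tight g W b p q ex A :
  (forall g' W' b' p' q' ex', (#|W'| < #|W|)%N ->
     admissible k g' W' b' p' q' ex' -> orientable k g' W' b') ->
  admissible k g W b p q ex -> A \subset W -> (1 < #|A|)%N -> A != W ->
  ~~ exempt ex W A -> (bnd g p q A <= demand k b p q A)%N ->
  orientable k g W b.
Proof.
move=> IH adm AW A1 AT Aex tight.
have /card_gt0P[a aA] : (0 < #|A|)%N by apply: leq_trans A1.
apply: (orientable_compose (W := W) aA).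
  apply: IH (admissible_contract k_gt1 AW aA A1 adm).
  exact: contracted_card.
move=> o oo oA.
have AltW : A \proper W by rewrite properEneq AT.
pose ex' := if ex is Some x then if x \in A then Some x else None else None.
apply: (IH _ _ _ (fun v => p v + headsn g A o v)%N (fun v => q v + tailsn g A o v)%N ex').
  exact: proper_card.
case: adm => h1 h2 h3 h4 h5 h6.
apply: (admissible_inner k_gt1 AW) => //.
- move=> B BA B0 BT Bex; apply: h4 => //; first exact: subset_trans AW.
    apply: contraNneq BT => BW; rewrite eqEsubset BA BW.
    exact: AW.
  move: Aex Bex; rewrite /ex'; case: (ex) => [x|] //=; case: ifP => xA Aex /=.
    apply: contra => /orP[->//|/eqP BE].
    move: AT; rewrite eqEsubset AW /=; case/negP; apply/subsetP => v vW.
    case: (v =P x) => [->//|/eqP vx]; apply: (subsetP BA).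
    by rewrite BE in_setD1 vx.
  move=> _; apply: contra Aex => /orP[/eqP BE|/eqP BE].
    by move: BA; rewrite BE sub1set xA.
  apply/orP; right; rewrite eqEsubset -{2}BE BA andbT.
  by apply/subsetP => v vA; rewrite in_setD1 (subsetP AW _ vA) andbT; apply: contraFneq xA => <-.
- move=> x; rewrite /ex'; case: ex h4 h6 {ex'} Aex => [z|] // h4 h6 /= Aex.
  case: ifP => // xA [zx]; subst z; have [xW cx lx] := h6 _ erefl.
  (* The prescription at [x] is 0, so [A] and [A :\ x] have the same demand; it is at least the
     [bnd] of [A], which is tight, and at most that of [A :\ x]. *)
  split=> //; apply: leq_trans tight _.
  have -> : demand k b p q A = demand k b p q (A :\ x).
    rewrite /demand (betaD1 _ _ _ xA); congr (_ + _)%N.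
    apply: dist2k_cong => //.
    by have := congD cx (cong_refl k (beta b p q (A :\ x))); rewrite add0r.
  apply: h4.
  + by apply: subset_trans AW; apply: subsetDl.
  + by rewrite -card_gt0; have := cardsD1 x A; rewrite xA; lia.
  + by apply/eqP => h; move: xW; rewrite -h in_setD1 eqxx.
  + rewrite /= negb_or; apply/andP; split.
      by apply/eqP => /setP/(_ x); rewrite in_setD1 in_set1 eqxx.
    apply: contraNneq AT => h; rewrite -(setD1K xA) h.
    by rewrite setD1K.
Qed.

Section Exempt.

Variables (g : E -> V * V) (W : {set V}) (b : V -> int) (p q : V -> nat) (x : V).

(** This lifts the path z0, [x], [y]: one edge from z0 to [x] now ends in [y], and [e0] disappears.
    [beta] is unchanged, and [bnd] drops, by 2, only for sets containing [x] but not [y]. *)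
Lemma admissible_pass e0 y b' p' :
  admissible k g W b p q (Some x) -> spacious k g W b p q (Some x) ->
  joined (g e0) x y -> x != y ->
  (forall v, p' v + (v == x) = p v + (v == y))%N ->
  (forall v, b' v = b v + (-1) * (v == x : nat)%:Z + 1 * (v == y : nat)%:Z) ->
  admissible k (upd g e0 (x, x)) W b' p' q (Some x).
Proof.
move=> [h1 h2 h3 h4 h5 h6] sp j xy hp hb.
have [xW yW] := joined_in h1 j xy.
have Dg A : (bnd (upd g e0 (x, x)) p' q A + ((x \in A) (+) (y \in A)) + (x \in A) =
    bnd g p q A + (y \in A))%N.
  have := bnd_upd g p q e0 (x, x) A; rewrite crossing_loop (crossing_joined A j).
  have := @load_change _ p q p' q x y 1 1 A; rewrite !mul1n /bnd => hl.
  have {hl} := hl (fun v => ltac:(by have := hp v; clear; lia)).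
  by clear; lia.
have Bb A : beta b' p' q A = beta b p q A.
  rewrite (@beta_change _ b p q b' p' q x x 0 0 A); first by rewrite !mul0r !addr0.
  by move=> v; rewrite hb; have := hp v; clear; lia.
have dm A : demand k b' p' q A = demand k b p q A by rewrite /demand Bb.
split=> //.
- by move=> e; rewrite /upd; case: ifP => [_|_ /h1//]; rewrite /nonloop eqxx.
- move=> A AW; have [m hm] := h2 _ AW; rewrite Bb hm; have := Dg A.
  case: (x \in A); case: (y \in A) => /= hD.
  + by exists m; move: hD; clear; lia.
  + by exists (m + 1); move: hD; clear; lia.
  + by exists m; move: hD; clear; lia.
  + by exists m; move: hD; clear; lia.
- by rewrite (sum_change W hb) xW yW /= mulr1 mul1r subrK.
- move=> A AW A0 AT Aex; have := h4 A AW A0 AT Aex; have := Dg A; rewrite dm.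
  case: (boolP (x \in A)) => xA; case: (boolP (y \in A)) => yA /=; try by clear; lia.
  have [Ax|A2] := set_split xA; first by move: Aex; rewrite Ax /= eqxx.
  by have := sp _ AW A2 AT Aex; clear; lia.
- by have := Dg W; move: h5; rewrite dm xW yW; clear; lia.
- move=> z [<-]; have [_ cx lx] := h6 _ erefl; split=> //; first by rewrite Bb.
  have := Dg [set x]; have := hp x; move: lx; rewrite !load1 !in_set1 !eqxx (eq_sym y) (negPf xy).
  by clear; lia.
Qed.

(** [bnd] drops, by 2, only for sets with [u] and [w] on one side and [x] on the other. Larger sets
    are spacious and [[set x]] is exempt; there remains [[set u]] with [u = w], whence the last
    hypothesis. *)
Lemma admissible_lift e1 e2 u w :
  admissible k g W b p q (Some x) -> spacious k g W b p q (Some x) ->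
  joined (g e1) u x -> joined (g e2) x w -> u != x -> w != x -> e1 != e2 ->
  load p q [set x] = 0%N ->
  (u = w -> [set u] != W :\ x -> (demand k b p q [set u] + 2 <= bnd g p q [set u])%N) ->
  admissible k (upd (upd g e1 (u, w)) e2 (x, x)) W b p q (Some x).
Proof.
move=> [h1 h2 h3 h4 h5 h6] sp j1 j2 ux wx e12 lx huw.
have [uW xW] := joined_in h1 j1 ux.
have [_ wW] : x \in W /\ w \in W by apply: (joined_in h1 j2); rewrite eq_sym.
have e21 : (e2 == e1) = false by rewrite eq_sym (negPf e12).
have Dg A : (bnd (upd (upd g e1 (u, w)) e2 (x, x)) p q A +
    ((u \in A) (+) (x \in A)) + ((x \in A) (+) (w \in A)) =
    bnd g p q A + ((u \in A) (+) (w \in A)))%N.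
  by have := cutd_lift x A j1 j2 e12; rewrite /bnd; clear; lia.
split=> //.
- move=> e; rewrite /upd; case: ifP => [_|_]; first by rewrite /nonloop eqxx.
  by case: ifP => [//|_ /h1].
- move=> A AW; have [m hm] := h2 _ AW; rewrite hm; have := Dg A.
  case: (x \in A); case: (u \in A); case: (w \in A) => /= hD;
    try by exists m; move: hD; clear; lia.
  + by exists (m + 1); move: hD; clear; lia.
  + by exists (m + 1); move: hD; clear; lia.
- move=> A AW A0 AT Aex; have := h4 A AW A0 AT Aex; have := Dg A.
  case: (boolP (x \in A)) => xA.
    have [Ax|A2] := set_split xA; first by move: Aex; rewrite Ax /= eqxx.
    have := sp _ AW A2 AT Aex.
    by case: (u \in A); case: (w \in A) => /=; clear; lia.
  case: (boolP (u \in A)) => uA; case: (boolP (w \in A)) => wA /=; try by clear; lia.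
  have [Au|A2] := set_split uA; last by have := sp _ AW A2 AT Aex; clear; lia.
  subst A; have /huw : u = w by move: wA; rewrite in_set1 => /eqP.
  move: Aex; rewrite /= negb_or => /andP[_ hx] /(_ hx).
  by clear; lia.
- by have := Dg W; move: h5; rewrite xW uW wW /=; clear; lia.
- move=> z [<-]; have [_ cx _] := h6 _ erefl; split=> //.
  by rewrite lx.
Qed.

Lemma admissible_drop : (1 < #|W|)%N ->
  admissible k g W b p q (Some x) -> bnd g p q [set x] = 0%N ->
  admissible k g (W :\ x) b p q None /\ cong k (b x) 0.
Proof.
move=> W1 [h1 h2 h3 h4 h5 h6] bx; have [xW cx _] := h6 _ erefl.
have lx : load p q [set x] = 0%N by move: bx; rewrite /bnd; clear; lia.
have gx : cutd g [set x] = 0%N by move: bx; rewrite /bnd; clear; lia.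
have cbx : cong k (b x) 0.
  move: cx lx; rewrite beta1 load1 => cx lx.
  by have -> : b x = b x + (q x)%:Z - (p x)%:Z by move: lx; clear; lia.
split=> //; split=> //.
- exact: closed_ends_drop.
- by move=> A /subsetD1P[AW _]; apply: h2.
- have := congD h3 (congN cbx); rewrite (big_setD1 x xW) /= oppr0 addr0.
  by rewrite addrAC subrr add0r.
- move=> A AW A0 AT _; apply: h4 => //; first by case/subsetD1P: AW.
    by apply/eqP => AE; case/subsetD1P: AW => _; rewrite AE xW.
  rewrite /= (negPf AT) orbF; apply/eqP => AE; case/subsetD1P: AW => _.
  by rewrite AE in_set1 eqxx.
- have -> : bnd g p q (W :\ x) = bnd g p q W.
    by rewrite /bnd cutdD1 // (cutdT h1) (loadD1 p q xW) gx lx.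
  have -> : demand k b p q (W :\ x) = demand k b p q W; last by [].
  rewrite /demand (betaD1 _ _ _ xW); congr (_ + _)%N; apply: dist2k_cong => //.
  apply: cong_sym.
  by have := congD cx (cong_refl k (beta b p q (W :\ x))); rewrite add0r.
Qed.

Lemma orientable_drop : cutd g [set x] = 0%N -> cong k (b x) 0 ->
  orientable k g (W :\ x) b -> orientable k g W b.
Proof.
move=> gx bx [o oo ho]; exists o => // v vW.
case: (v =P x) => [->|/eqP vx]; last by apply: ho; rewrite in_setD1 vx.
suff -> : net g o [set x] = 0 by apply: cong_sym.
rewrite /net big1 // => e _.
have : crossing (g e) [set x] = false.
  by apply/negP => c; move: gx; rewrite /cutd (bigD1 e) //= c; lia.
rewrite /crossing /incidence !in_set1.
by case: (_ == x); case: (_ == x); rewrite // subrr mulr0.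
Qed.

End Exempt.

End Extension.

(** * Vertices of prescription 0, and the case in which all vertices can emit *)

Section ExtensionTheorem.

Variables (V E : finType) (k : nat).
Hypothesis k_gt1 : (1 < k)%N.

Implicit Types (g : E -> V * V) (o : E -> int) (A B W : {set V}) (a u v w x y : V).
Implicit Types (b : V -> int) (p q : V -> nat) (ex : option V).

Lemma bnd_neq1 b p q g x : (exists m : int, beta b p q [set x] = (bnd g p q [set x])%:Z + 2 * m) ->
  cong k (beta b p q [set x]) 0 -> bnd g p q [set x] != 1%N.
Proof. by case=> m -> [i hi]; apply/eqP => h; move: hi; rewrite h; clear; lia. Qed.

Lemma nonloops_loop g e0 z : nonloop (g e0) -> (nonloops (upd g e0 (z, z)) < nonloops g)%N.
Proof.
by move=> ne; have := nonloops_upd g e0 (z, z); rewrite nonloop_refl ne; clear; lia.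
Qed.

Lemma orientable_pass n g W b p q x :
  (forall g' b' p' q', (nonloops g' < n)%N ->
     admissible k g' W b' p' q' (Some x) -> orientable k g' W b') ->
  (nonloops g < n.+1)%N -> admissible k g W b p q (Some x) ->
  spacious k g W b p q (Some x) -> (0 < cutd g [set x])%N -> (0 < p x)%N ->
  orientable k g W b.
Proof.
move=> IHn ng adm sp /cutd_gt0[e0 /crossing1P[y yx j]] px.
have xy : x != y by rewrite eq_sym.
have ne : nonloop (g e0) by rewrite (nonloop_joined j).
pose b' v := b v + (-1) * (v == x : nat)%:Z + 1 * (v == y : nat)%:Z.
pose p' v := (p v + (v == y) - (v == x))%N.
apply: (@orientable_delete _ _ _ _ e0 x y x W b b' j).
  by move=> v _; rewrite /b'; clear; lia.
apply: (IHn _ _ p' q); first by have := nonloops_loop x ne; move: ng; clear; lia.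
apply: (admissible_pass adm sp j xy) => // v.
by rewrite /p'; case: (v =P x) => [->|_]; [move: px; rewrite (negPf xy)|]; clear; lia.
Qed.

(** An exempt [x] is stripped of its edges: those to z0 are lifted together with edges of [g], then
    the remaining ones in pairs, if possible towards different neighbours. Each lifting reduces the
    number of non-loops, and an isolated [x] is dropped. *)
Lemma orientable_exempt n g W b p q x :
  (forall g' W' b' p' q' ex', (#|W'| < #|W|)%N ->
     admissible k g' W' b' p' q' ex' -> orientable k g' W' b') ->
  (nonloops g < n)%N -> admissible k g W b p q (Some x) -> orientable k g W b.
Proof.
move=> IH; elim: n g b p q => // n IHn g b p q ng adm.
case: (leqP #|W| 1) => W1; first exact: orientable_small adm.
have [sp|[A [AW A1 AT Aex At]]] := spaciousPn k_gt1 adm; last first.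
  exact: (orientable_tight k_gt1 IH adm AW).
have [xW cx lx] := adm_ex adm erefl.
case: (posnP (bnd g p q [set x])) => [bx0|bx].
  have [admx bx] := admissible_drop k_gt1 W1 adm bx0.
  have gx : cutd g [set x] = 0%N by move: bx0; rewrite /bnd; clear; lia.
  apply: (orientable_drop k_gt1 gx bx).
  by apply: IH admx; rewrite [X in (_ < X)%N](cardsD1 x W) xW.
case: (posnP (load p q [set x])) => [l0|l0]; last first.
  (* At most half of the edges at [x] go to z0, so there is an edge of [g] to be lifted with one of
     them. *)
  have c0 : (0 < cutd g [set x])%N by move: lx l0; rewrite /bnd; clear; lia.
  have := l0; rewrite load1 addn_gt0 => /orP[px|qx].
    exact: (orientable_pass IHn ng adm sp c0 px).
  apply: orientableNN.
  exact: (orientable_pass IHn ng (admissibleN k_gt1 adm) (spaciousN k_gt1 sp) c0 qx).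
have c2 : (1 < cutd g [set x])%N.
  have := bnd_neq1 (adm_par adm (A := [set x]) _) cx; rewrite sub1set => /(_ xW).
  by move: bx l0; rewrite /bnd; clear; lia.
have /cutd_gt0[e1 c1] : (0 < cutd g [set x])%N by apply: leq_trans c2.
have [u ux j1] := crossing1P c1.
have j1' : joined (g e1) u x by rewrite joinedC.
have lift e2 w : joined (g e2) x w -> w != x -> e1 != e2 ->
    (u = w -> [set u] != W :\ x -> (demand k b p q [set u] + 2 <= bnd g p q [set u])%N) ->
    orientable k g W b.
  move=> j2 wx e12 huw.
  apply: (orientable_lift (z := x) j1' j2 e12).
  apply: (IHn _ _ p q); last exact: (admissible_lift adm sp).
  exact: leq_trans (nonloops_lift x j1' j2 e12 ux wx) ng.
case: (boolP [exists e, [&& e != e1, crossing (g e) [set x] & ~~ joined (g e) x u]]).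
  case/existsP=> e2 /and3P[e21 /crossing1P[w wx j2] nj].
  apply: (lift e2 w) => //; first by rewrite eq_sym.
  by move=> uw; move: nj; rewrite uw j2.
rewrite negb_exists => /forallP h.
have allu e : crossing (g e) [set x] -> joined (g e) x u.
  by have := h e; case: (e =P e1) => [->//|_] /= + c; rewrite c /= negbK.
have [e2 e21 /allu j2] := cutd_gt1 e1 c2.
apply: (lift e2 u) => //; first by rewrite eq_sym.
move=> _ uWx; have [uW _] := joined_in (adm_ends adm) j1' ux.
have Au : [set x; u] :\ x = [set u].
  by apply/setP => v; rewrite !inE; case: (v =P x) => [->|]; rewrite // eq_sym (negPf ux).
have xA : x \in [set x; u] by rewrite !inE eqxx.
have AW : [set x; u] \subset W by rewrite subUset !sub1set xW.
(* All edges at [x] end in [u], so [[set u]] has at least the [bnd] of [[set x; u]] and, as the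
   prescription at [x] is 0, the same demand: it inherits the slack of the pair. *)
have := sp [set x; u] AW; rewrite cards2 eq_sym ux => /(_ isT).
have -> : [set x; u] != W by apply: contraNneq uWx => <-; rewrite Au.
move=> /(_ isT); rewrite /= negb_or.
have -> : [set x; u] != [set x].
  by apply: contraTneq isT => /setP/(_ u); rewrite !inE eqxx orbT (negPf ux).
have -> : [set x; u] != W :\ x.
  by apply: contraTneq isT => /setP/(_ x); rewrite !inE eqxx.
move=> /(_ isT).
have -> : demand k b p q [set x; u] = demand k b p q [set u].
  rewrite /demand (betaD1 _ _ _ xA) Au; congr (_ + _)%N; apply: dist2k_cong => //.
  by have := congD cx (cong_refl k (beta b p q [set u])); rewrite add0r.
suff : (bnd g p q [set x; u] <= bnd g p q [set u])%N by clear; lia.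
rewrite /bnd (loadD1 p q xA) Au l0 add0n leq_add2r.
apply: leq_sum => e _; case: (boolP (crossing (g e) [set x])) => [/allu j|].
  by rewrite (crossing_joined _ j) !inE !eqxx orbT.
rewrite /crossing !inE.
by case: (_ == x); case: (_ == x) => //=; do 2 case: (_ == u).
Qed.

(** Add the inequalities for [A] and [W :\: A]. Their loads sum to at most [2k - 2 + t(W)] by
    [adm_out], and [t(W) <= t(A) + t(W :\: A)], so twice the cut is at least [2k - 2]. *)
Lemma cutd_pos g W b p q A : admissible k g W b p q None ->
  A \subset W -> A != set0 -> A != W -> (0 < cutd g A)%N.
Proof.
move=> adm AW A0 AT; have h4 := adm_cut adm; have h5 := adm_out adm.
have gW := adm_ends adm.
have dA := h4 A AW A0 AT isT.
have cWA := cutdC A gW.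
have dWA : (demand k b p q (W :\: A) <= bnd g p q (W :\: A))%N.
  apply: h4 => //; first exact: subsetDl.
    by rewrite setD_eq0; apply: contra AT => WA; rewrite eqEsubset AW.
  apply: contra A0 => /eqP h; rewrite -subset0; apply/subsetP => v vA.
  by have := subsetP AW _ vA; rewrite -h inE vA.
have lW : load p q W = (load p q A + load p q (W :\: A))%N.
  by rewrite /load (big_setID A) /= (setIidPr AW).
have bW : beta b p q W = beta b p q A + beta b p q (W :\: A).
  by rewrite /beta (big_setID A) /= (setIidPr AW).
move: dA dWA h5; rewrite /demand /bnd cWA bW lW (cutdT gW).
have := dist2kD k_gt1 (beta b p q A) (beta b p q (W :\: A)).
by move: k_gt1; clear; lia.
Qed.

(** In terms of the numbers [P] and [Q] of edges leaving and entering z0, [adm_out]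
    says that [min P Q < k] and [max P Q < 2k]; hence [j < k] edges into z0 may be
    added when [Q = 0]. *)
Lemma demand_fill (P j : nat) (n : int) : (0 < j < k)%N ->
  (P <= 2 * k - 2 + dist2k k (n * (2 * k%:Z) - P%:Z))%N ->
  (P + j <= 2 * k - 2 + dist2k k (n * (2 * k%:Z) - P%:Z + j%:Z))%N.
Proof.
move=> /andP[j0 jk] hP.
have {hP} P2k : (P < 2 * k)%N.
  have := dist2k_min k_gt1 (n * (2 * k%:Z) - P%:Z) (n - 1).
  by move: hP k_gt1; clear; lia.
have [m [_]] := dist2kP k_gt1 (n * (2 * k%:Z) - P%:Z + j%:Z).
move: (dist2k _ _) => d h.
have {h} : exists i : int, j%:Z - P%:Z = i * (2 * k%:Z) + d%:Z \/
    j%:Z - P%:Z = i * (2 * k%:Z) - d%:Z.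
  by exists (m - n); move: h; clear; lia.
case=> i; case: (ltrgtP i 0) => [i0|i0|->].
- have : i * (2 * k%:Z) <= - (2 * k%:Z).
    have : 0 <= (-1 - i) * (2 * k%:Z) by apply: mulr_ge0; move: i0; clear; lia.
    by clear; lia.
  by move: j0 jk P2k; clear; lia.
- have : 2 * k%:Z <= i * (2 * k%:Z).
    have : 0 <= (i - 1) * (2 * k%:Z) by apply: mulr_ge0; move: i0; clear; lia.
    by clear; lia.
  by move: j0 jk P2k; clear; lia.
- by move: j0 jk P2k; clear; lia.
Qed.

Lemma dist2k_top (n : int) : dist2k k (n * (2 * k%:Z) + k%:Z) = k /\
  (dist2k k (n * (2 * k%:Z) + k%:Z + 1%:Z)%R < k)%N.
Proof.
split; last first.
  have := dist2k_min k_gt1 (n * (2 * k%:Z) + k%:Z + 1%:Z) (n + 1).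
  by move: k_gt1; clear; lia.
have [m [le h]] := dist2kP k_gt1 (n * (2 * k%:Z) + k%:Z).
move: (dist2k _ _) le h => d le h.
have {h} : exists i : int, i * (2 * k%:Z) + k%:Z = d%:Z \/ i * (2 * k%:Z) + k%:Z = - d%:Z.
  by exists (n - m); move: h; clear; lia.
case=> i; case: (lerP 0 i) => i0.
  have : 0 <= i * (2 * k%:Z) by apply: mulr_ge0; move: i0; clear; lia.
  by move: le; clear; lia.
have : 0 <= (-1 - i) * (2 * k%:Z) by apply: mulr_ge0; move: i0; clear; lia.
by move: le; clear; lia.
Qed.

(** Here [y] has prescription [t] with [0 < t < k] and no spare edges.  Adding
    [k - t] edges from [y] to z0 raises the prescription to [k], which is the same
    as [-k] modulo [2k], and then an edge from [x] to [y] can be deleted. *)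
Lemma orientable_emit n g W b p q :
  (forall g' b' p' q', (nonloops g' < n)%N ->
     admissible k g' W b' p' q' None -> orientable k g' W b') ->
  (nonloops g < n.+1)%N -> admissible k g W b p q None ->
  spacious k g W b p q None -> (1 < #|W|)%N ->
  (forall v, v \in W -> (0 < dist2k k (beta b p q [set v]))%N) ->
  (forall v, v \in W -> can_emit k g b p q v) ->
  (forall v, v \in W -> q v = 0%N) ->
  (forall e x y, joined (g e) x y -> x != y ->
     ~~ (can_emit k g b p q x && can_absorb k g b p q y)) ->
  orientable k g W b.
Proof.
move=> IHn ng adm sp W1 t0 em q0 noab.
have /card_gt0P[x xW] : (0 < #|W|)%N by apply: leq_trans W1.
have neqW v : [set v] != W.
  by apply: contraTneq W1 => <-; rewrite cards1.
have /cutd_gt0[e0 /crossing1P[y yx j]] : (0 < cutd g [set x])%N.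
  by apply: cutd_pos adm _ _ _; rewrite ?sub1set // -card_gt0 cards1.
have xy : x != y by rewrite eq_sym.
have [_ yW] := joined_in (adm_ends adm) j xy.
have := noab _ _ _ j xy; rewrite em //= negb_or -!leqNgt => /andP[tight up].
have [tk [m hm]] := dist2k_up k_gt1 (t0 _ yW) up.
move: tk hm; set t := dist2k k _ => tk hm.
have tight' : bnd g p q [set y] = (2 * k - 2 + t)%N.
  apply/eqP; rewrite eqn_leq {1}tight //=.
  by apply: (adm_cut adm) => //; rewrite ?sub1set // -card_gt0 cards1.
pose jj := (k - t)%N.
have jk : (0 < jj < k)%N by have := t0 _ yW; rewrite -/t /jj; move: tk; clear; lia.
pose q' v := (q v + jj * (v == y))%N.
have Dq A : (bnd g p q' A = bnd g p q A + jj * (y \in A))%N.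
  rewrite /bnd -addnA -(@load_change _ p q p q' y y 0 jj A) ?mul0n ?addn0 //.
  by move=> v; rewrite /q'; clear; lia.
have Bq A : beta b p q' A = beta b p q A + (jj * (y \in A))%N%:Z.
  rewrite (@beta_change _ b p q b p q' y y jj 0 A); first by clear; lia.
  by move=> v; rewrite /q'; clear; lia.
have out : (bnd g p q' W <= demand k b p q' W)%N.
  have := adm_out adm; rewrite /demand Bq Dq yW muln1.
  have -> : bnd g p q W = (\sum_(v in W) p v)%N.
    rewrite /bnd (cutdT (adm_ends adm)); apply: eq_bigr => v vW; rewrite q0 //; lia.
  have [i hi] := adm_sum adm.
  have -> : beta b p q W = i * (2 * k%:Z) - (\sum_(v in W) p v)%N%:Z.
    rewrite -[i * _]add0r -hi (big_morph _ PoszD (erefl _)) -sumrB.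
    by apply: eq_bigr => v vW; rewrite q0 //; lia.
  exact: demand_fill.
have [adm' sp'] := admissible_add k_gt1 adm sp yW (fun v => erefl (q' v)) out.
have em' : can_emit k g b p q' x.
  have := em _ xW; rewrite /can_emit /demand Bq Dq in_set1 (negPf yx) muln0 addn0.
  by have -> : beta b p q [set x] + 0%N%:Z = beta b p q [set x] by clear; lia.
have ab' : can_absorb k g b p q' y.
  rewrite /can_absorb; apply/orP; right; rewrite Bq set11 muln1.
  have -> : beta b p q [set y] + jj%:Z = m * (2 * k%:Z) + k%:Z.
    by rewrite hm /jj; move: tk; clear; lia.
  by have [-> ->] := dist2k_top m.
have ne : nonloop (g e0) by rewrite (nonloop_joined j).
pose b' v := b v + (-1) * (v == x : nat)%:Z + 1 * (v == y : nat)%:Z.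
apply: (@orientable_delete _ _ _ _ e0 x y x W b b' j).
  by move=> v _; rewrite /b'; clear; lia.
apply: (IHn _ _ p q'); first by have := nonloops_loop x ne; move: ng; clear; lia.
exact: (admissible_delete k_gt1 adm' sp' j xy em' ab').
Qed.

End ExtensionTheorem.

(** * The extension theorem *)

Section MainExtension.

Variables (V E : finType) (k : nat).
Hypothesis k_gt1 : (1 < k)%N.

Implicit Types (g : E -> V * V) (o : E -> int) (A B W : {set V}) (a u v w x y : V).
Implicit Types (b : V -> int) (p q : V -> nat) (ex : option V).

(** [W] and [W :\ x] have the same demand, so [adm_out] bounds the load of [W] by the [bnd] of
    [W :\ x]; hence the load at [x] is at most its cut. *)
Lemma admissible_exempt0 g W b p q x : admissible k g W b p q None -> (1 < #|W|)%N ->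
  x \in W -> cong k (beta b p q [set x]) 0 -> admissible k g W b p q (Some x).
Proof.
move=> adm W1 xW cx; have [h1 h2 h3 h4 h5 _] := adm.
split=> //; first by move=> A AW A0 AT _; apply: h4.
move=> z [<-]; split=> //.
have : (demand k b p q (W :\ x) <= bnd g p q (W :\ x))%N.
  apply: h4 => //; first exact: subsetDl.
    by rewrite -card_gt0; have := cardsD1 x W; rewrite xW; clear -W1; lia.
  by apply: contraTneq xW => <-; rewrite !inE eqxx.
have -> : demand k b p q (W :\ x) = demand k b p q W.
  rewrite /demand (betaD1 _ _ _ xW); congr (_ + _)%N; apply: dist2k_cong => //.
  apply: cong_sym.
  by have := congD cx (cong_refl k (beta b p q (W :\ x))); rewrite add0r.
move: h5; rewrite /bnd (cutdT h1) (cutdD1 x h1) (loadD1 p q xW).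
by clear; lia.
Qed.

Lemma orientable_remove n m g W b p q x :
  (forall g' b' p' q', (nonloops g' < n.+1)%N -> (load p' q' W < m)%N ->
     admissible k g' W b' p' q' None -> orientable k g' W b') ->
  (nonloops g < n.+1)%N -> (load p q W < m.+1)%N -> admissible k g W b p q None ->
  spacious k g W b p q None -> x \in W -> can_emit k g b p q x -> (0 < q x)%N ->
  orientable k g W b.
Proof.
move=> IH ng lm adm sp xW em qx.
pose q' v := (q v - (v == x))%N.
have hq v : (q v = q' v + (v == x))%N.
  by rewrite /q'; case: (v =P x) => [->|_]; move: qx; clear; lia.
apply: (IH _ _ p q') => //; last exact: (admissible_remove k_gt1 adm sp xW em hq).
have := @load_change _ p q p q' x x 1 0 W; rewrite xW mul1n mul0n => hl.
have {hl} := hl (fun v => ltac:(by rewrite hq; clear; lia)).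
by move: lm; clear; lia.
Qed.

(** Each move removes a non-loop, possibly adding load, or keeps [g] and removes an edge at z0;
    hence the nested induction. When no prescription is 0, every vertex can emit or absorb, since
    one of the two shifts brings it closer to a multiple of [2k]. *)
Lemma orientable_plain n m g W b p q :
  (forall g' W' b' p' q' ex', (#|W'| < #|W|)%N ->
     admissible k g' W' b' p' q' ex' -> orientable k g' W' b') ->
  (nonloops g < n)%N -> (load p q W < m)%N ->
  admissible k g W b p q None -> orientable k g W b.
Proof.
move=> IH; elim: n m g b p q => // n IHn; elim=> // m IHm g b p q ng lm adm.
case: (leqP #|W| 1) => W1; first exact: orientable_small adm.
have [sp|[A [AW A1 AT Aex At]]] := spaciousPn k_gt1 adm; last first.
  exact: (orientable_tight k_gt1 IH adm AW).
have IHn' g' b' p' q' : (nonloops g' < n)%N -> admissible k g' W b' p' q' None ->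
  orientable k g' W b' by move=> ng'; apply: (IHn (load p' q' W).+1).
case: (pickP [pred x in W | dist2k k (beta b p q [set x]) == 0%N]) => [x|nz].
  case/andP=> xW /eqP/(dist2k_eq0 k_gt1) cx.
  apply: (@orientable_exempt _ _ _ k_gt1 (nonloops g).+1 _ _ _ p q x) => //.
  exact: admissible_exempt0.
have t0 v : v \in W -> (0 < dist2k k (beta b p q [set v]))%N.
  by move=> vW; have := nz v; rewrite inE vW /= lt0n => ->.
have ea v : v \in W -> can_emit k g b p q v || can_absorb k g b p q v.
  move=> vW; rewrite /can_emit /can_absorb.
  by case: (dist2k_step k_gt1 (t0 v vW)) => ->; rewrite !orbT.
case: (pickP [pred x in W | can_emit k g b p q x && (0 < q x)%N]) => [x|nq].
  by case/and3P=> xW em qx; apply: (orientable_remove IHm ng lm adm sp xW em qx).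
case: (pickP [pred x in W | can_absorb k g b p q x && (0 < p x)%N]) => [x|np].
  case/and3P=> xW ab px; apply: orientableNN.
  apply: (orientable_remove IHm ng _ (admissibleN k_gt1 adm) (spaciousN k_gt1 sp) xW _ px).
    by rewrite loadC.
  by rewrite can_emitN.
case: (pickP [pred e | nonloop (g e) &
   (can_emit k g b p q (g e).1 && can_absorb k g b p q (g e).2) ||
   (can_emit k g b p q (g e).2 && can_absorb k g b p q (g e).1)]) => [e0|noe].
  have del x y : nonloop (g e0) -> joined (g e0) x y -> can_emit k g b p q x ->
      can_absorb k g b p q y -> orientable k g W b.
    move=> ne j em ab; have xy : x != y by rewrite -(nonloop_joined j).
    pose b' v := b v + (-1) * (v == x : nat)%:Z + 1 * (v == y : nat)%:Z.
    apply: (@orientable_delete _ _ _ _ e0 x y x W b b' j).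
      by move=> v _; rewrite /b'; clear; lia.
    apply: (IHn' _ _ p q); first by have := nonloops_loop x ne; move: ng; clear; lia.
    exact: (admissible_delete k_gt1 adm sp j xy em ab).
  case/andP=> ne /orP[/andP[em ab]|/andP[em ab]].
    by apply: (del _ _ ne _ em ab); apply: joined_refl.
  by apply: (del _ _ ne _ em ab); rewrite joinedC; apply: joined_refl.
have noab e x y : joined (g e) x y -> x != y ->
    ~~ (can_emit k g b p q x && can_absorb k g b p q y).
  move=> j xy; have := noe e; rewrite inE (nonloop_joined j) xy /=.
  by case/orP: j => /eqP -> /= /negbT; rewrite negb_or => /andP[].
(* An edge leaving the set [A] of emitting vertices would lead to an absorbing one and could be
   deleted. So the cut of [A] is empty, and by [cutd_pos] either [A] is empty or [A = W]; reversal
   turns the first case into the second. *)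
pose A := [set v in W | can_emit k g b p q v].
have AW : A \subset W by apply/subsetP => v; rewrite inE => /andP[].
case: (A =P set0) => [A0|/eqP A0].
  have abs v : v \in W -> can_absorb k g b p q v.
    by move=> vW; have := ea v vW; have /setP/(_ v) := A0; rewrite !inE vW /= => ->.
  apply: orientableNN.
  apply: (orientable_emit k_gt1 _ ng (admissibleN k_gt1 adm) (spaciousN k_gt1 sp) W1) => //.
  - by move=> v vW; rewrite betaN dist2kN //; apply: t0.
  - by move=> v vW; rewrite can_emitN //; apply: abs.
  - by move=> v vW; have := np v; rewrite inE vW abs //= lt0n => /negbFE/eqP.
  - move=> e x y j xy; rewrite can_emitN // can_absorbN // andbC.
    by apply: (noab e); rewrite 1?joinedC // eq_sym.
case: (A =P W) => [AE|/eqP AT].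
  have em v : v \in W -> can_emit k g b p q v by rewrite -AE inE => /andP[].
  apply: (orientable_emit k_gt1 _ ng adm sp W1) => //.
  by move=> v vW; have := nq v; rewrite inE vW em //= lt0n => /negbFE/eqP.
have /cutd_gt0[e ce] := cutd_pos k_gt1 adm AW A0 AT.
have ne : nonloop (g e).
  by apply: contraTneq ce; rewrite /crossing => ->; rewrite addbb.
have [W1' W2'] := adm_ends adm ne.
have bad x y : joined (g e) x y -> x \in W -> y \in W -> x \in A -> y \notin A -> False.
  move=> j xW yW; rewrite !inE xW yW /= => ex ey.
  have xy : x != y by rewrite -(nonloop_joined j).
  have := noab _ _ _ j xy; rewrite ex /=.
  by have := ea _ yW; rewrite (negPf ey) /= => ->.
move: ce; rewrite /crossing.
case: (boolP ((g e).1 \in A)) => i; case: (boolP ((g e).2 \in A)) => j // _.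
  by case: (bad _ _ (joined_refl _) W1' W2' i j).
have jj : joined (g e) (g e).2 (g e).1 by rewrite joinedC joined_refl.
by case: (bad _ _ jj W2' W1' j i).
Qed.

Theorem orientable_admissible g W b p q ex :
  admissible k g W b p q ex -> orientable k g W b.
Proof.
have [n] := ubnP #|W|; elim: n g W b p q ex => // n IH g W b p q ex Wn adm.
have IH' g' W' b' p' q' ex' : (#|W'| < #|W|)%N ->
    admissible k g' W' b' p' q' ex' -> orientable k g' W' b'.
  by move=> W'W; apply: IH; apply: leq_trans W'W _.
case: ex adm => [x|] adm.
  exact: (@orientable_exempt _ _ _ k_gt1 (nonloops g).+1 _ _ _ p q x).
exact: (@orientable_plain (nonloops g).+1 (load p q W).+1 _ _ _ p q).
Qed.

End MainExtension.

(** * Cuts of odd sets *)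

Section Deficient.

Variables (V E : finType) (k : nat).
Hypothesis k_gt1 : (1 < k)%N.

Implicit Types (g : E -> V * V) (o : E -> int) (A B W X Y : {set V}) (a u v w x y : V).
Implicit Types (b : V -> int).

Definition even_at g W b := forall A, A \subset W -> exists m : int,
  \sum_(v in A) b v = (cutd g A)%:Z + 2 * m.

Definition deficient g b A : bool :=
  (cutd g A < 2 * k - 2 + dist2k k (\sum_(v in A) b v))%N.

Let zero (v : V) : nat := 0%N.

Lemma bnd_zero g A : bnd g zero zero A = cutd g A.
Proof. by rewrite /bnd /load big1 ?addn0. Qed.

Lemma beta_zero b A : beta b zero zero A = \sum_(v in A) b v.
Proof. by apply: eq_bigr => v _; rewrite /zero; lia. Qed.

Lemma orientable_or_deficient g W b : closed_ends g W -> even_at g W b ->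
  cong k (\sum_(v in W) b v) 0 ->
  orientable k g W b \/ exists A, [/\ A \subset W, A != set0, A != W, deficient g b A &
    forall B, B \subset A -> B != set0 -> B != A -> ~~ deficient g b B].
Proof.
move=> gW par tot.
pose P A := [&& A \subset W, A != set0, A != W & deficient g b A].
case: (pickP P) => [A0 PA0|noP].
  right; case: (arg_minnP (fun A : {set V} => #|A|) PA0) => A /and4P[AW A0' AT dA] Amin.
  exists A; split=> // B BA B0 BAn; apply/negP => dB.
  have BltA : B \proper A by rewrite properEneq BAn.
  have : P B.
    rewrite /P (subset_trans BA AW) B0 dB andbT /=.
    by apply: contraTneq BltA => ->; rewrite properE AW andbF.
  by move=> /Amin; rewrite leqNgt proper_card.
left; apply: (orientable_admissible k_gt1 (p := zero) (q := zero) (ex := None)); split=> //.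
- by move=> A /par; rewrite beta_zero bnd_zero.
- move=> A AW A0 AT _; have := noP A; rewrite /P AW A0 AT /= /deficient.
  by rewrite /demand beta_zero bnd_zero => /negbT; rewrite -leqNgt.
- by rewrite bnd_zero cutdT.
Qed.

Lemma orientable_contract g W b A a : A \subset W -> a \in A -> (1 < #|A|)%N ->
  even_at g W b -> deficient g b A ->
  (forall B, B \subset A -> B != set0 -> B != A -> ~~ deficient g b B) ->
  orientable k (contract A a g) (a |: (W :\: A)) (push A a b) -> orientable k g W b.
Proof.
move=> AW aA A1 par dA minA og; apply: (orientable_compose aA og) => o oo oA.
apply: (orientable_admissible k_gt1 (p := fun v => (zero v + headsn g A o v)%N)
  (q := fun v => (zero v + tailsn g A o v)%N) (ex := None)).
apply: (admissible_inner k_gt1 AW) => //.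
- by move=> B /par; rewrite beta_zero bnd_zero.
- by rewrite /demand beta_zero bnd_zero ltnW.
- move=> B BA B0 BT _; rewrite /demand beta_zero bnd_zero leqNgt.
  exact: minA.
Qed.

Lemma even_at_contract g W b A a : A \subset W -> a \in A -> even_at g W b ->
  even_at (contract A a g) (a |: (W :\: A)) (push A a b).
Proof.
move=> AW aA par B BW; rewrite sum_push cutd_contract.
by apply: par; apply: preim_sub.
Qed.

Lemma closed_ends_upd g W e0 r : closed_ends g W -> (nonloop r -> r.1 \in W /\ r.2 \in W) ->
  closed_ends (upd g e0 r) W.
Proof. by move=> gW hr e; rewrite /upd; case: ifP => // _; apply: gW. Qed.

Lemma dist2k_half (n : nat) : dist2k k (k * n)%N%:Z = if odd n then k else 0%N.
Proof.
rewrite -{1}(odd_double_half n); case: (odd n) => /=.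
  rewrite -[RHS](dist2k_top k_gt1 n./2%:Z).1; congr (dist2k k _).
  by rewrite add1n -addnn; clear; lia.
apply/(dist2k_eq0 k_gt1); exists n./2%:Z.
by rewrite -addnn; clear; lia.
Qed.

Lemma half_cong (n : nat) : cong k (k * n)%N%:Z 0 <-> ~~ odd n.
Proof.
have := dist2k_eq0 k_gt1 (k * n)%N%:Z; rewrite dist2k_half.
case: (odd n) => /= -[h1 h2]; split=> // h; last exact: h1.
by have := h2 h; move: k_gt1; clear; lia.
Qed.

Section Parity.

Variable f : V -> nat.

Let sf A := (\sum_(v in A) f v)%N.

Lemma sumf_UI X Y : (sf X + sf Y = sf (X :|: Y) + sf (X :&: Y))%N.
Proof.
have -> : sf (X :|: Y) = (sf Y + sf (X :\: Y))%N.
  rewrite /sf (big_setID Y) /=; congr (_ + _)%N; apply: eq_bigl => v; rewrite !inE.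
    by case: (v \in Y); rewrite ?orbT ?andbF.
  by case: (v \in Y); rewrite ?orbF.
by rewrite /sf [X in (X + _)%N](big_setID Y) /=; clear; lia.
Qed.

Lemma sumf_D X Y : sf X = (sf (X :&: Y) + sf (X :\: Y))%N.
Proof. by rewrite /sf (big_setID Y). Qed.

Lemma cutd_submod g X Y : (cutd g (X :|: Y) + cutd g (X :&: Y) <= cutd g X + cutd g Y)%N.
Proof.
rewrite /cutd -!big_split; apply: leq_sum => e _; rewrite /crossing !inE.
by do 4 case: (_ \in _).
Qed.

Lemma cutd_posimod g X Y e x u : joined (g e) x u -> x \notin X -> x \notin Y ->
  u \in X -> u \in Y ->
  (cutd g (X :\: Y) + cutd g (Y :\: X) + 2 <= cutd g X + cutd g Y)%N.
Proof.
move=> j xX xY uX uY.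
rewrite /cutd -!big_split (bigD1 e) //= [X in (_ <= X)%N](bigD1 e) //=.
rewrite !(crossing_joined _ j) !inE uX uY (negPf xX) (negPf xY) /= add0n addnC.
rewrite leq_add2l; apply: leq_sum => i _; rewrite /crossing !inE.
by do 4 case: (_ \in _).
Qed.

(** If the other end [w] of [e2] lies outside a maximal tight odd set containing
    [u], then no tight odd set contains both ends of the new edge, by uncrossing. *)
Lemma parity_lift (c : nat) g W x : closed_ends g W ->
  (forall A, A \subset W -> ~~ odd (cutd g A)) -> ~~ odd (sf W) -> ~~ odd c ->
  (forall A, A \subset W -> odd (sf A) -> (c <= cutd g A)%N) ->
  x \in W -> ~~ odd (f x) -> (0 < cutd g [set x])%N ->
  exists e1 e2 u w, [/\ joined (g e1) u x, joined (g e2) x w, e1 != e2, u != x & w != x] /\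
    forall A, A \subset W -> odd (sf A) ->
      (c <= cutd (upd (upd g e1 (u, w)) e2 (x, x)) A)%N.
Proof.
move=> gW ev evW evc cut xW fx c0.
have [e1 /crossing1P[u ux j1]] := cutd_gt0 c0.
have j1' : joined (g e1) u x by rewrite joinedC.
pose tight X := [&& X \subset W, x \notin X, u \in X, odd (sf X) & (cutd g X <= c)%N].
have [e2 [w [e12 wx j2 hw]]] : exists e2 w, [/\ e1 != e2, w != x, joined (g e2) x w &
    forall Y, tight Y -> w \notin Y].
  case: (pickP tight) => [X0 tX0|no]; last first.
    have [e2 e21 /crossing1P[w wx j2]] : exists2 e, e != e1 & crossing (g e) [set x].
      apply: cutd_gt1; have := ev [set x]; rewrite sub1set => /(_ xW).
      by move: c0; case: (cutd g [set x]) => // [[]].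
    exists e2, w; split=> //; first by rewrite eq_sym.
    by move=> Y; rewrite no.
  case: (arg_maxnP (fun X : {set V} => #|X|) tX0) => X /and5P[XW xX uX oX cX] Xmax.
  case: (pickP [pred e | crossing (g e) [set x] && ~~ crossing (g e) X]) => [e2|all].
    case/andP=> /crossing1P[w wx j2]; rewrite (crossing_joined _ j2) (negPf xX) /= => wX.
    exists e2, w; split=> //.
      by apply: contraNneq wX => e12; move: uX; have := crossing_joined X j2;
         rewrite -e12 (crossing_joined X j1) (negPf xX) /= => ->.
    move=> Y /and5P[YW xY uY oY cY]; apply/negP => wY.
    case: (boolP (odd (sf (X :&: Y)))) => oI.
      have oU : odd (sf (X :|: Y)).
        by have := congr1 odd (sumf_UI X Y); rewrite !oddD oX oY oI; case: (odd _).
      have XYW : X :|: Y \subset W by rewrite subUset XW.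
      have tU : tight (X :|: Y).
        rewrite /tight XYW !inE negb_or xX xY uX oU /=.
        have IW : X :&: Y \subset W by apply: subset_trans XW; apply: subsetIl.
        by have := cut _ IW oI; have := cutd_submod g X Y; move: cX cY; clear; lia.
      have := Xmax _ tU; rewrite /= leqNgt proper_card // properUl //.
      by apply/negP => /subsetP/(_ _ wY); rewrite (negPf wX).
    have oXY : odd (sf (X :\: Y)).
      by have := congr1 odd (sumf_D X Y); rewrite oddD oX (negPf oI).
    have oYX : odd (sf (Y :\: X)).
      by have := congr1 odd (sumf_D Y X); rewrite oddD oY setIC (negPf oI).
    have := cut _ (subset_trans (subsetDl _ _) XW) oXY.
    have := cut _ (subset_trans (subsetDl _ _) YW) oYX.
    by have := cutd_posimod j1 xX xY uX uY; move: cX cY; clear; lia.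
  (* Every edge at [x] enters [X], so adding [x], whose [f] is even, would give an odd set with a
     cut smaller than [c]. *)
  have : (cutd g (x |: X) + cutd g [set x] <= cutd g X)%N.
    rewrite /cutd -big_split; apply: leq_sum => e _.
    case: (boolP (crossing (g e) [set x])) => [ce|].
      have := all e; rewrite /= ce /= => /negbFE.
      have [z zx j] := crossing1P ce; rewrite !(crossing_joined _ j) (negPf xX) /= => zX.
      by rewrite !inE eqxx zX orbT.
    rewrite /crossing !inE.
    by case: ((g e).1 =P x) => [->|_]; case: ((g e).2 =P x) => [->|_] //=; rewrite addn0.
  have sxX : x |: X \subset W by rewrite subUset sub1set xW.
  have : odd (sf (x |: X)) by rewrite /sf big_setU1 //= oddD (negPf fx).
  by move=> /(cut _ sxX); move: c0 cX; clear; lia.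
exists e1, e2, u, w; split=> // A AW oA.
have key B : B \subset W -> odd (sf B) -> x \notin B ->
    (c <= cutd (upd (upd g e1 (u, w)) e2 (x, x)) B)%N.
  move=> BW oB xB; have := cutd_lift x B j1' j2 e12; rewrite (negPf xB) addbF /=.
  case: (boolP (u \in B)) => uB; case: (boolP (w \in B)) => wB /=;
    try by have := cut _ BW oB; clear; lia.
  (* Since [c] and all cuts are even, an odd set that is not tight has a cut of at least [c + 2] and
     can afford the loss of two edges. *)
  have : ~~ (cutd g B <= c)%N.
    by apply: contraL wB => cB; apply: hw; rewrite /tight BW xB uB oB.
  have := odd_double_half (cutd g B); have := odd_double_half c.
  by rewrite (negPf (ev _ BW)) (negPf evc) -!addnn; clear; lia.
case: (boolP (x \in A)) => xA; last exact: key.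
have [uW _] := joined_in gW j1' ux.
have [_ wW] : x \in W /\ w \in W by apply: (joined_in gW j2); rewrite eq_sym.
have gW' : closed_ends (upd (upd g e1 (u, w)) e2 (x, x)) W.
  by apply: closed_ends_upd => //; apply: closed_ends_upd.
(* The complement avoids [x], is odd because the total is even, and has the same cut. *)
rewrite -(cutdC A gW'); apply: key; first exact: subsetDl.
  by have := congr1 odd (sumf_D W A); rewrite (setIidPr AW) oddD oA (negPf evW); case: (odd _).
by rewrite inE xA.
Qed.

End Parity.

Lemma sum_mulk (f : V -> nat) A : \sum_(v in A) (k * f v)%N%:Z = (k * \sum_(v in A) f v)%N%:Z.
Proof. by rewrite -(big_morph _ PoszD (erefl _)) -big_distrr. Qed.

Lemma even_at_parity g W (f : V -> nat) : ~~ odd k ->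
  (forall A, A \subset W -> ~~ odd (cutd g A)) -> even_at g W (fun v => (k * f v)%N%:Z).
Proof.
move=> evk ev A AW; rewrite sum_mulk; have := ev _ AW.
have := odd_double_half (cutd g A); have := odd_double_half (k * \sum_(v in A) f v).
rewrite oddM (negPf evk) /=; case: (odd (cutd g A)) => //= h1 h2 _.
exists ((k * \sum_(v in A) f v)./2%:Z - (cutd g A)./2%:Z).
by move: h1 h2; rewrite -!addnn; clear; lia.
Qed.

Theorem orientable_parity g W (f : V -> nat) : ~~ odd k -> closed_ends g W ->
  (forall A, A \subset W -> ~~ odd (cutd g A)) -> ~~ odd (\sum_(v in W) f v) ->
  (forall A, A \subset W -> odd (\sum_(v in A) f v) -> (3 * k - 2 <= cutd g A)%N) ->
  orientable k g W (fun v => (k * f v)%N%:Z).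
Proof.
move=> evk.
have [n] := ubnP #|W|; elim: n g W f => // n IHn g W f Wn.
have [m] := ubnP (nonloops g); elim: m g => // m IHm g gm gW ev evW cut.
have par := even_at_parity f evk ev.
have tot : cong k (\sum_(v in W) (k * f v)%N%:Z) 0 by rewrite sum_mulk; apply/half_cong.
have [//|[A [AW A0 AT dA minA]]] := orientable_or_deficient gW par tot.
have /set0Pn[x xA] := A0.
have [Ax|A1] := set_split xA; last first.
  apply: (orientable_contract AW xA A1 par dA minA).
  apply: (@orientable_ext _ _ _ _ _ (fun v => (k * pushn A x f v)%N%:Z)).
    by move=> v _; rewrite /push /pushn big_distrr /= (big_morph _ PoszD (erefl _)).
  apply: IHn.
  - by have := contracted_card AW xA A1; move: Wn; clear; lia.
  - exact: closed_contract.
  - by move=> B BW; rewrite cutd_contract; apply/ev/preim_sub.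
  - by rewrite sum_pushn preimT.
  - by move=> B BW; rewrite sum_pushn cutd_contract; apply/cut/preim_sub.
subst A; have xW : x \in W by rewrite -sub1set.
(* For odd [f x] the distance is [k], and the assumed [3 * k - 2] is the full demand; so a deficient
   vertex has even [f] and prescription 0. *)
have fx : ~~ odd (f x).
  apply: contraL dA => ox; rewrite /deficient big_set1 dist2k_half ox -leqNgt.
  have := cut _ AW; rewrite big_set1 => /(_ ox).
  by move: k_gt1; clear; lia.
case: (posnP (cutd g [set x])) => [c0|c0].
  apply: (orientable_drop k_gt1 c0); first exact/half_cong.
  have WxW : W :\ x \subset W by apply: subsetDl.
  apply: IHn.
  - by move: Wn; rewrite (cardsD1 x W) xW.
  - exact: closed_ends_drop.
  - by move=> B BW; apply/ev/(subset_trans BW).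
  - by move: evW; rewrite (big_setD1 x xW) oddD (negPf fx).
  - by move=> B BW; apply/cut/(subset_trans BW).
have ev3 : ~~ odd (3 * k - 2).
  rewrite oddB; first by rewrite oddM (negPf evk).
  by move: k_gt1; clear; lia.
have [e1 [e2 [u [w [[j1 j2 e12 ux wx] cut']]]]] :=
  parity_lift gW ev evW ev3 cut xW fx c0.
have [uW _] := joined_in gW j1 ux.
have [_ wW] : x \in W /\ w \in W by apply: (joined_in gW j2); rewrite eq_sym.
apply: (orientable_lift (z := x) j1 j2 e12).
apply: IHm => //.
- by have := nonloops_lift x j1 j2 e12 ux wx; move: gm; clear; lia.
- apply: closed_ends_upd; last by rewrite nonloop_refl.
  exact: closed_ends_upd.
- move=> A AW'; have := congr1 odd (cutd_lift x A j1 j2 e12).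
  rewrite !oddD (negPf (ev _ AW')).
  by case: (u \in A); case: (x \in A); case: (w \in A) => /=; case: (odd _).
Qed.

End Deficient.

(** * Edge-disjoint connected factors *)

Section Linked.

Variables (V E : finType).

Implicit Types (g : E -> V * V) (A B W U : {set V}) (u v w x y : V) (F : {set E}).

(** Connectivity of the factor [F] on [U], expressed through cuts. *)
Definition cut_edge g U F A e : bool :=
  [&& e \in F, (g e).1 \in U, (g e).2 \in U & crossing (g e) A].

Definition linked g U F : bool :=
  [forall A : {set V}, [&& A \subset U, A != set0 & A != U] ==> [exists e, cut_edge g U F A e]].

Lemma linkedP g U F :
  reflect (forall A, A \subset U -> A != set0 -> A != U -> exists e, cut_edge g U F A e)
    (linked g U F).
Proof.
apply: (iffP forallP) => [h A AU A0 AT|h A].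
  by have := h A; rewrite AU A0 AT => /existsP.
by apply/implyP => /and3P[AU A0 AT]; apply/existsP; apply: h.
Qed.

Lemma linkedPn g U F x : x \in U -> ~~ linked g U F ->
  exists A, [/\ A \subset U, x \in A, A != U & forall e, ~~ cut_edge g U F A e].
Proof.
move=> xU; rewrite negb_forall => /existsP[A]; rewrite negb_imply => /andP[/and3P[AU A0 AT]].
rewrite negb_exists => /forallP h; case: (boolP (x \in A)) => xA; first by exists A.
exists (U :\: A); split; [exact: subsetDl|by rewrite inE xA| |].
  apply: contra A0 => /eqP UA; rewrite -subset0; apply/subsetP => v vA.
  by have := subsetP AU _ vA; rewrite -UA inE vA.
move=> e; apply: contra (h e) => /and4P[eF e1 e2]; rewrite /cut_edge eF e1 e2 /=.
by rewrite /crossing !inE e1 e2 !andbT; do 2 case: (_ \in A).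
Qed.

Lemma crossing1_end r x y : joined r x y -> x != y -> crossing r [set x].
Proof. by move=> j xy; rewrite (crossing_joined _ j) !in_set1 eqxx eq_sym (negPf xy). Qed.

Lemma not_crossing1 r x A : ~~ crossing r [set x] -> crossing r A -> r.1 != x /\ r.2 != x.
Proof.
rewrite /crossing !in_set1.
by case: (r.1 =P x) => [->|_]; case: (r.2 =P x) => [->|_]; rewrite ?addbb.
Qed.

(** If both exchanges failed, the two cuts witnessing it would have a union that
    no edge of [F] crosses. *)
Lemma linked_exchange g W F e1 e2 x y1 y2 w : closed_ends g W ->
  linked g W F -> e1 \in F -> e2 \in F -> e1 != e2 ->
  joined (g e1) x y1 -> joined (g e2) x y2 -> y1 != x -> y2 != x -> w != x -> w \in W ->
  linked (upd g e1 (y1, w)) W F \/ linked (upd g e2 (y2, w)) W F.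
Proof.
move=> gW /linkedP lF e1F e2F e12 j1 j2 y1x y2x wx wW.
have xy1 : x != y1 by rewrite eq_sym.
have xy2 : x != y2 by rewrite eq_sym.
have [xW y1W] := joined_in gW j1 xy1; have [_ y2W] := joined_in gW j2 xy2.
have side e y : e \in F -> joined (g e) x y -> y \in W -> ~~ linked (upd g e (y, w)) W F ->
    exists A, [/\ A \subset W, x \in A, y \notin A, w \notin A &
      forall f, f != e -> ~~ cut_edge g W F A f].
  move=> eF j yW /(linkedPn xW)[A [AW xA AT h]].
  have hf f : f != e -> ~~ cut_edge g W F A f.
    by move=> fe; have := h f; rewrite /cut_edge /upd (negPf fe).
  have A0 : A != set0 by apply/set0Pn; exists x.
  have [f cf] := lF A AW A0 AT.
  have fe : f = e by apply: contraTeq cf => /hf.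
  have yA : y \notin A.
    by move: cf; rewrite fe => /and4P[_ _ _]; rewrite (crossing_joined _ j) xA.
  exists A; split=> //; have := h e; rewrite /cut_edge /upd eqxx eF /= yW wW /=.
  by rewrite /crossing /= (negPf yA).
case: (boolP (linked (upd g e1 (y1, w)) W F)) => [|n1]; first by left.
case: (boolP (linked (upd g e2 (y2, w)) W F)) => [|n2]; first by right.
have [A [AW xA y1A wA hA]] := side _ _ e1F j1 y1W n1.
have [B [BW xB y2B wB hB]] := side _ _ e2F j2 y2W n2.
have inF e y : e \in F -> joined (g e) x y -> y \in W ->
    [&& e \in F, (g e).1 \in W & (g e).2 \in W].
  by move=> -> j yW; case/orP: j => /eqP -> /=; rewrite xW yW.
have y2A : y2 \in A.
  have e21 : e2 != e1 by rewrite eq_sym.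
  have := hA e2 e21; have /and3P[i1 i2 i3] := inF _ _ e2F j2 y2W.
  by rewrite /cut_edge i1 i2 i3 (crossing_joined _ j2) xA /= negbK.
have y1B : y1 \in B.
  have := hB e1 e12; have /and3P[i1 i2 i3] := inF _ _ e1F j1 y1W.
  by rewrite /cut_edge i1 i2 i3 (crossing_joined _ j1) xB /= negbK.
have ABW : A :|: B \subset W by rewrite subUset AW.
have AB0 : A :|: B != set0 by apply/set0Pn; exists x; rewrite inE xA.
have ABT : A :|: B != W.
  by apply: contraNneq wA => h; move: wW; rewrite -h inE (negPf wB) orbF.
have [f /and4P[fF f1 f2 cf]] := lF _ ABW AB0 ABT.
have : crossing (g f) A || crossing (g f) B.
  by move: cf; rewrite /crossing !inE; do 4 case: (_ \in _).
case/orP=> c.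
  have fe : f = e1.
    by apply: contraTeq isT => /hA; rewrite /cut_edge fF f1 f2 c.
  by move: cf; rewrite fe (crossing_joined _ j1) !inE xA y1B orbT.
have fe : f = e2.
  by apply: contraTeq isT => /hB; rewrite /cut_edge fF f1 f2 c.
by move: cf; rewrite fe (crossing_joined _ j2) !inE xA y2A.
Qed.

(** If the edge found to leave [A] is the leaf edge at [x], then [x |: A] is left by another edge,
    which avoids [x]. *)
Lemma linked_leaf g W F h x : closed_ends g W -> linked g W F -> x \in W ->
  (forall e, e \in F -> crossing (g e) [set x] -> e = h) -> linked g (W :\ x) F.
Proof.
move=> gW /linkedP lF xW leaf; apply/linkedP => A /subsetD1P[AW xA] A0 AT.
have good f B : cut_edge g W F B f -> ~~ crossing (g f) [set x] ->
    crossing (g f) A -> cut_edge g (W :\ x) F A f.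
  move=> /and4P[fF f1 f2 _] nx c; have [n1 n2] := not_crossing1 nx c.
  by rewrite /cut_edge fF !in_setD1 n1 n2 f1 f2 c.
have AneW : A != W by apply: contraNneq xA => ->.
have [f cf] := lF A AW A0 AneW; case: (boolP (crossing (g f) [set x])) => cx; last first.
  by exists f; apply: (good _ _ cf cx); case/and4P: cf.
have [y yx j] := crossing1P cx.
have yA : y \in A by case/and4P: cf => _ _ _; rewrite (crossing_joined _ j) (negPf xA).
have fh : f = h by apply: (leaf _ _ cx); case/and4P: cf.
have xAW : x |: A \subset W by rewrite subUset sub1set xW.
have xA0 : x |: A != set0 by apply/set0Pn; exists x; rewrite !inE eqxx.
have xAT : x |: A != W.
  by apply: contraNneq AT => <-; rewrite setU1K.
have [f' cf'] := lF _ xAW xA0 xAT; exists f'.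
have nx : ~~ crossing (g f') [set x].
  apply/negP => cx'; have f'h : f' = h by apply: (leaf _ _ cx'); case/and4P: cf'.
  by case/and4P: cf' => _ _ _; rewrite f'h -fh (crossing_joined _ j) !inE eqxx yA orbT.
apply: (good _ _ cf' nx); case/and4P: cf' => _ _ _ c; have [n1 n2] := not_crossing1 nx c.
by move: c; rewrite /crossing !inE (negPf n1) (negPf n2).
Qed.

(** If [A] separates [y1] from [y2], the new edge crosses it; otherwise [A] is enlarged by [x], as
    for a leaf. *)
Lemma linked_pair g W F e1 e2 x y1 y2 : closed_ends g W -> linked g W F -> x \in W ->
  joined (g e1) x y1 -> joined (g e2) x y2 -> y1 != x -> y2 != x -> e1 != e2 ->
  e1 \in F ->
  (forall e, e \in F -> crossing (g e) [set x] -> e = e1 \/ e = e2) ->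
  linked (upd (upd g e1 (y1, y2)) e2 (x, x)) (W :\ x) F.
Proof.
move=> gW /linkedP lF xW j1 j2 y1x y2x e12 e1F two; apply/linkedP => A /subsetD1P[AW xA] A0 AT.
have xy1 : x != y1 by rewrite eq_sym.
have xy2 : x != y2 by rewrite eq_sym.
have [_ y1W] := joined_in gW j1 xy1; have [_ y2W] := joined_in gW j2 xy2.
have good f B : cut_edge g W F B f -> ~~ crossing (g f) [set x] ->
    crossing (g f) A -> cut_edge (upd (upd g e1 (y1, y2)) e2 (x, x)) (W :\ x) F A f.
  move=> /and4P[fF f1 f2 _] nx c; have [n1 n2] := not_crossing1 nx c.
  have fe1 : (f == e1) = false.
    by apply: contraNF nx => /eqP ->; exact: crossing1_end j1 xy1.
  have fe2 : (f == e2) = false.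
    by apply: contraNF nx => /eqP ->; exact: crossing1_end j2 xy2.
  by rewrite /cut_edge /upd fe1 fe2 fF !in_setD1 n1 n2 f1 f2 c.
have AneW : A != W by apply: contraNneq xA => ->.
case: (boolP ((y1 \in A) (+) (y2 \in A))) => [c12|].
  by exists e1; rewrite /cut_edge /upd (negPf e12) eqxx e1F /= !in_setD1 y1x y2x y1W y2W.
rewrite negb_add => /eqP same.
have [f cf] := lF A AW A0 AneW; case: (boolP (crossing (g f) [set x])) => cx; last first.
  by exists f; apply: (good _ _ cf cx); case/and4P: cf.
have y1A : y1 \in A.
  case/and4P: cf => fF _ _; case: (two f fF cx) => ->.
    by rewrite (crossing_joined _ j1) (negPf xA).
  by rewrite (crossing_joined _ j2) (negPf xA) same.
have xAW : x |: A \subset W by rewrite subUset sub1set xW.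
have xA0 : x |: A != set0 by apply/set0Pn; exists x; rewrite !inE eqxx.
have xAT : x |: A != W.
  by apply: contraNneq AT => <-; rewrite setU1K.
have [f' cf'] := lF _ xAW xA0 xAT; exists f'.
have nx : ~~ crossing (g f') [set x].
  apply/negP => cx'; case/and4P: cf' => fF _ _; case: (two f' fF cx') => ->.
    by rewrite (crossing_joined _ j1) !inE eqxx y1A orbT.
  by rewrite (crossing_joined _ j2) !inE eqxx -same y1A orbT.
apply: (good _ _ cf' nx); case/and4P: cf' => _ _ _ c; have [n1 n2] := not_crossing1 nx c.
by move: c; rewrite /crossing !inE (negPf n1) (negPf n2).
Qed.

Lemma linked_eq g g' U F : (forall e, e \in F -> (g e).1 \in U -> (g e).2 \in U -> g' e = g e) ->
  linked g U F -> linked g' U F.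
Proof.
move=> h /linkedP lF; apply/linkedP => A AU A0 AT.
have [e /and4P[eF e1 e2 c]] := lF A AU A0 AT.
by exists e; rewrite /cut_edge (h e eF e1 e2) eF e1 e2 c.
Qed.

Lemma linked_contract g W F A a : A \subset W -> a \in A -> linked g W F ->
  linked (contract A a g) (a |: (W :\: A)) F.
Proof.
move=> AW aA /linkedP lF; apply/linkedP => B BW B0 BT.
have [e /and4P[eF e1 e2 c]] := lF _ (preim_sub AW aA BW) (preim0 BW B0) (preim_neqT AW aA BW BT).
exists e; rewrite /cut_edge eF crossing_contract c andbT /=.
by apply/andP; split; apply: collapse_in.
Qed.

End Linked.

(** * Degrees of the factors at a vertex, and peeling off its edges *)

Section Trees.

Variables (V E : finType) (k : nat).
Hypothesis k_gt1 : (1 < k)%N.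

Variable T : 'I_(2 * k - 2) -> {set E}.
Hypothesis T_disjoint : forall i j, i != j -> [disjoint T i & T j].

Implicit Types (g : E -> V * V) (A B W U : {set V}) (u v w x y : V) (F : {set E}).
Implicit Types (b : V -> int) (J : {set 'I_(2 * k - 2)}).

Record balanced g W b : Prop := Balanced {
  bal_ends : closed_ends g W;
  bal_even : even_at g W b;
  bal_sum : cong k (\sum_(v in W) b v) 0 }.

Definition solved W := forall g b, balanced g W b -> (forall i, linked g W (T i)) ->
  orientable k g W b.

Lemma balanced_drop g W b x : balanced g W b -> x \in W -> cutd g [set x] = 0%N ->
  cong k (b x) 0 -> balanced g (W :\ x) b.
Proof.
move=> [h1 h2 h3] xW gx bx; split; first exact: closed_ends_drop.
  by move=> A AW; apply: h2; apply: subset_trans AW _; apply: subsetDl.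
have := congD h3 (congN bx); rewrite (big_setD1 x xW) /= oppr0 addr0.
by rewrite addrAC subrr add0r.
Qed.

Lemma balanced_delete g W b e0 x y z b' : balanced g W b -> joined (g e0) x y -> x != y ->
  (forall v, b' v = b v + (-1) * (v == x : nat)%:Z + 1 * (v == y : nat)%:Z) ->
  balanced (upd g e0 (z, z)) W b'.
Proof.
move=> [h1 h2 h3] j xy hb; have [xW yW] := joined_in h1 j xy; split.
- by apply: closed_ends_upd; rewrite // nonloop_refl.
- move=> A AW; have [m hm] := h2 _ AW.
  rewrite (sum_change A hb) hm.
  have := cutd_upd g e0 (z, z) A; rewrite crossing_loop (crossing_joined A j).
  case: (x \in A); case: (y \in A) => /= hD.
  + by exists m; move: hD; clear; lia.
  + by exists m; move: hD; clear; lia.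
  + by exists (m + 1); move: hD; clear; lia.
  + by exists m; move: hD; clear; lia.
- by rewrite (sum_change W hb) xW yW /= mulr1 mul1r subrK.
Qed.

Lemma balanced_lift g W b e1 e2 u x w z : balanced g W b ->
  joined (g e1) u x -> joined (g e2) x w -> e1 != e2 -> u != x -> w != x ->
  balanced (upd (upd g e1 (u, w)) e2 (z, z)) W b.
Proof.
move=> [h1 h2 h3] j1 j2 e12 ux wx.
have [uW _] := joined_in h1 j1 ux.
have [_ wW] : x \in W /\ w \in W by apply: (joined_in h1 j2); rewrite eq_sym.
split=> //.
  by apply: closed_ends_upd; [apply: closed_ends_upd|rewrite nonloop_refl].
move=> A AW; have [m hm] := h2 _ AW; rewrite hm.
have := cutd_lift z A j1 j2 e12.
case: (x \in A); case: (u \in A); case: (w \in A) => /= hD;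
  try by exists m; move: hD; clear; lia.
+ by exists (m + 1); move: hD; clear; lia.
+ by exists (m + 1); move: hD; clear; lia.
Qed.

Lemma balanced1 g W b x : balanced g W b -> x \in W ->
  exists m : int, b x = (cutd g [set x])%:Z + 2 * m.
Proof. by move=> [_ h _] xW; have := h [set x]; rewrite big_set1 sub1set; apply. Qed.

Lemma linked_delete g W e0 x y z : joined (g e0) x y ->
  (forall i, linked g (W :\ x) (T i)) -> forall i, linked (upd g e0 (z, z)) (W :\ x) (T i).
Proof.
move=> j lT i; apply: linked_eq (lT i) => e _.
rewrite !in_setD1 /upd; case: (e =P e0) => [->|//].
by case/orP: j => /eqP -> /=; rewrite eqxx.
Qed.

(** The edges at [x] are used up one by one, each oriented so that the distance stays at most the
    degree. The factors are already connected on [W :\ x] and lose no edge there. *)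
Lemma orientable_peel g W b x : solved (W :\ x) -> x \in W -> balanced g W b ->
  (dist2k k (b x) <= cutd g [set x])%N -> (forall i, linked g (W :\ x) (T i)) ->
  orientable k g W b.
Proof.
move=> IH xW; have [n] := ubnP (cutd g [set x]); elim: n g b => // n IHn g b cn bal dc lT.
case: (posnP (cutd g [set x])) => [c0|c0].
  have bx : cong k (b x) 0.
    by apply/(dist2k_eq0 k_gt1); move: dc; rewrite c0; clear; lia.
  apply: (orientable_drop k_gt1 c0 bx); apply: IH => //.
  exact: balanced_drop.
have [e0 /crossing1P[y yx j]] := cutd_gt0 c0.
have xy : x != y by rewrite eq_sym.
have cd : (cutd (upd g e0 (x, x)) [set x] + 1 = cutd g [set x])%N.
  have := cutd_upd g e0 (x, x) [set x].
  by rewrite (crossing1_end j xy) crossing_loop addn0.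
have emit c : c = 1 \/ c = -1 ->
    (dist2k k (b x - c) < cutd g [set x])%N -> orientable k g W b.
  case=> -> hd.
    pose b' v := b v + (-1) * (v == x : nat)%:Z + 1 * (v == y : nat)%:Z.
    apply: (@orientable_delete _ _ _ _ e0 x y x W b b' j).
      by move=> v _; rewrite /b'; clear; lia.
    apply: IHn.
    - by move: cn cd; clear; lia.
    - exact: (balanced_delete _ bal j xy).
    - rewrite /b' eqxx (negPf xy) /=.
      have -> : b x + -1 * 1%N%:Z + 1 * 0%N%:Z = b x - 1 by clear; lia.
      by move: hd cd; clear; lia.
    - exact: linked_delete j lT.
  pose b' v := b v + (-1) * (v == y : nat)%:Z + 1 * (v == x : nat)%:Z.
  have j' : joined (g e0) y x by rewrite joinedC.
  apply: (@orientable_delete _ _ _ _ e0 y x x W b b' j').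
    by move=> v _; rewrite /b'; clear; lia.
  apply: IHn.
  - by move: cn cd; clear; lia.
  - exact: (balanced_delete _ bal j' yx).
  - rewrite /b' eqxx (negPf xy) /=.
    have -> : b x + -1 * 0%N%:Z + 1 * 1%N%:Z = b x - -1 by clear; lia.
    by move: hd cd; clear; lia.
  - exact: linked_delete j lT.
case: (posnP (dist2k k (b x))) => [d0|d0].
  apply: (emit 1); first by left.
  (* The distance is 0, so the positive degree is even, hence at least 2, and the distance may rise
     to 1. *)
  have [m hm] := balanced1 bal xW; have [i hi] := dist2k_par k_gt1 (b x).
  have [+ _] := dist2k_dec k_gt1 (b x).
  have -> : b x - 1 = b x - 1%:Z by [].
  by move: hm hi c0; rewrite d0; clear; lia.
have [h|h] := dist2k_step k_gt1 d0.
  by apply: (emit 1); [left|apply: leq_trans h dc].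
apply: (emit (-1)); [by right|].
by rewrite opprK; apply: leq_trans h dc.
Qed.

Lemma joined_disjoint i j e e' : i != j -> e \in T i -> e' \in T j -> e != e'.
Proof.
move=> /T_disjoint/pred0P/(_ e) /= h ei ej; apply: contraFneq h => ee.
by rewrite ei ee ej.
Qed.

Definition tdeg g x i : nat := (\sum_(e in T i) crossing (g e) [set x])%N.

Lemma sum_tdeg g x J : (\sum_(i in J) tdeg g x i <= cutd g [set x])%N.
Proof.
rewrite /tdeg (exchange_big_dep predT) //=; apply: leq_sum => e _.
case: (pickP [pred i in J | e \in T i]) => [i /andP[iJ ei]|no]; last first.
  by rewrite big_pred0.
rewrite (big_pred1 i) // => j /=; apply/andP/eqP => [[jJ ej]|->//].
by apply/eqP; apply: contraTT ej => ji; apply/negP => ej;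
   have := joined_disjoint ji ej ei; rewrite eqxx.
Qed.

Lemma tdeg_pos g W x i : x \in W -> (1 < #|W|)%N -> linked g W (T i) ->
  (0 < tdeg g x i)%N.
Proof.
move=> xW W1 /linkedP/(_ [set x]); rewrite sub1set => /(_ xW).
have -> : [set x] != set0 by rewrite -card_gt0 cards1.
have -> : [set x] != W by apply: contraTneq W1 => <-; rewrite cards1.
move=> /(_ isT isT)[e /and4P[eT _ _ c]].
by rewrite /tdeg (bigD1 e) //= c.
Qed.

Lemma tdeg_two g x i : (1 < tdeg g x i)%N -> exists e1 e2, [/\ e1 != e2, e1 \in T i, e2 \in T i,
  crossing (g e1) [set x] & crossing (g e2) [set x]].
Proof.
move=> t1; have /existsP[e1 /andP[i1 c1]] : [exists e, (e \in T i) && crossing (g e) [set x]].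
  apply: contraTT t1; rewrite negb_exists => /forallP h; rewrite /tdeg big1 // => e eT.
  by have := h e; rewrite eT /= => /negPf ->.
have /existsP[e2 /and3P[e21 i2 c2]] :
    [exists e, [&& e != e1, e \in T i & crossing (g e) [set x]]].
  apply: contraTT t1; rewrite negb_exists => /forallP h.
  rewrite /tdeg (bigD1 e1) //= big1 ?addn0 -?leqNgt ?leq_b1 // => e /andP[eT ee1].
  by have := h e; rewrite eT ee1 /= => /negPf ->.
by exists e1, e2; split=> //; rewrite eq_sym.
Qed.

Lemma tdeg_le1 g x i e1 e2 : tdeg g x i = 1%N -> e1 \in T i -> e2 \in T i ->
  crossing (g e1) [set x] -> crossing (g e2) [set x] -> e1 = e2.
Proof.
move=> t1 i1 i2 c1 c2; apply/eqP; apply: contraPT t1 => e12.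
rewrite /tdeg (bigD1 e1) //= (bigD1 e2) /=; last by rewrite i2 eq_sym.
by rewrite c1 c2.
Qed.

Lemma tdeg_le2 g x i e1 e2 e : tdeg g x i = 2%N -> e1 != e2 -> e1 \in T i -> e2 \in T i ->
  crossing (g e1) [set x] -> crossing (g e2) [set x] -> e \in T i ->
  crossing (g e) [set x] -> e = e1 \/ e = e2.
Proof.
move=> t2 e12 i1 i2 c1 c2 ie ce.
case: (e =P e1) => [|/eqP ee1]; [by left|right]; apply/eqP; apply: contraPT t2 => ee2.
rewrite /tdeg (bigD1 e1) //= (bigD1 e2) /=; last by rewrite i2 eq_sym.
rewrite (bigD1 e) /=; last by rewrite ie ee1 ee2.
by rewrite c1 c2 ce.
Qed.

End Trees.

(** * Orientations from [2k - 2] edge-disjoint connected factors *)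

Section TreeTheorem.

Variables (V E : finType) (k : nat).
Hypothesis k_gt1 : (1 < k)%N.

Variable T : 'I_(2 * k - 2) -> {set E}.
Hypothesis T_disjoint : forall i j, i != j -> [disjoint T i & T j].

Implicit Types (g : E -> V * V) (A B W U : {set V}) (u v w x y : V) (F : {set E}).
Implicit Types (b : V -> int) (J : {set 'I_(2 * k - 2)}).

Lemma linked_tdeg1 g W x i : closed_ends g W -> x \in W -> linked g W (T i) ->
  tdeg T g x i = 1%N -> linked g (W :\ x) (T i).
Proof.
move=> gW xW lT t1.
have [h /andP[hT hc]] : exists h, (h \in T i) && crossing (g h) [set x].
  apply/existsP; apply: contraPT t1; rewrite negb_exists => /forallP h.
  rewrite /tdeg big1 // => e eT; have := h e; rewrite eT /= => /negPf -> //.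
by apply: (linked_leaf (h := h)) => // e eT ec; apply: (tdeg_le1 t1).
Qed.

Lemma cutd_lift1 g e1 e2 u x w : joined (g e1) u x -> joined (g e2) x w -> e1 != e2 ->
  u != x -> w != x ->
  (cutd (upd (upd g e1 (u, w)) e2 (x, x)) [set x] + 2 = cutd g [set x])%N.
Proof.
move=> j1 j2 e12 ux wx; have := cutd_lift x [set x] j1 j2 e12.
by rewrite !in_set1 eqxx (negPf ux) (negPf wx) /= addn0 -addnA.
Qed.

(** The factors in [J] still have to be disconnected from [x].  A factor of degree
    1 at [x] is freed by lending its edge to a factor of larger degree; if no
    factor has degree 1, then all degrees at [x] are 2 and a factor is freed by splitting off
    its own two edges. *)
Lemma orientable_split g W b x J : solved T (W :\ x) -> x \in W -> (1 < #|W|)%N ->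
  balanced k g W b -> (forall i, i \in J -> linked g W (T i)) ->
  (forall i, i \notin J -> linked g (W :\ x) (T i)) ->
  (cutd g [set x] + dist2k k (b x) <= 2 * #|J|)%N -> orientable k g W b.
Proof.
move=> IH xW W1; have [n] := ubnP #|J|; elim: n J g => // n IHn J g Jn bal lJ lJ' deg.
have gW := bal_ends bal.
have tpos i : i \in J -> (0 < tdeg T g x i)%N.
  by move=> iJ; apply: tdeg_pos (lJ i iJ).
have tsum := sum_tdeg T_disjoint g x J.
have lift J' e1 e2 u w : joined (g e1) u x -> joined (g e2) x w -> e1 != e2 ->
    u != x -> w != x -> (#|J'| < #|J|)%N -> (2 * #|J| <= 2 * #|J'| + 2)%N ->
    (forall i, i \in J' -> linked (upd (upd g e1 (u, w)) e2 (x, x)) W (T i)) ->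
    (forall i, i \notin J' -> linked (upd (upd g e1 (u, w)) e2 (x, x)) (W :\ x) (T i)) ->
    orientable k g W b.
  move=> j1 j2 e12 ux wx J'J JJ' l1 l2; apply: (orientable_lift (z := x) j1 j2 e12).
  apply: (IHn J') => //; first by move: Jn J'J; clear; lia.
    exact: balanced_lift bal j1 j2 e12 ux wx.
  by have := cutd_lift1 j1 j2 e12 ux wx; move: deg JJ'; clear; lia.
case: (pickP [pred i in J | (1 < tdeg T g x i)%N]) => [i /andP[iJ ti]|no]; last first.
  have t1 i : i \in J -> tdeg T g x i = 1%N.
    move=> iJ; have := tpos i iJ; have := no i; rewrite inE iJ /=.
    by case: (tdeg T g x i) => [|[]].
  (* All factors in [J] have [x] as a leaf. From [|J| <= d(x)] and [d(x) + t(x) <= 2|J|] it follows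
     that [t(x) <= d(x)], so the edges at [x] can be peeled off. *)
  have Jc : (#|J| <= cutd g [set x])%N.
    by apply: leq_trans tsum; rewrite -sum1_card; apply: leq_sum => i /t1 ->.
  apply: (orientable_peel k_gt1 IH xW bal).
    by move: deg Jc; clear; lia.
  move=> i; case: (boolP (i \in J)) => [iJ|]; last exact: lJ'.
  exact: linked_tdeg1 (lJ i iJ) (t1 i iJ).
have [e1 [e2 [e12 i1 i2 c1 c2]]] := tdeg_two ti.
have [y1 y1x j1] := crossing1P c1; have [y2 y2x j2] := crossing1P c2.
case: (pickP [pred j in J | tdeg T g x j == 1%N]) => [j /andP[jJ /eqP tj]|no1].
  have ij : i != j by apply: contraTneq ti => ->; rewrite tj.
  have [h /andP[hT hc]] : exists h, (h \in T j) && crossing (g h) [set x].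
    apply/existsP; apply: contraPT tj; rewrite negb_exists => /forallP h.
    rewrite /tdeg big1 // => e eT; have := h e; rewrite eT /= => /negPf -> //.
  have [w wx jh] := crossing1P hc.
  have xw : x != w by rewrite eq_sym.
  have [_ wW] := joined_in gW jh xw.
  have fin e y : e \in T i -> joined (g e) x y -> y != x ->
      linked (upd g e (y, w)) W (T i) -> orientable k g W b.
    move=> ei je yx le; have eh : e != h := joined_disjoint T_disjoint ij ei hT.
    have je' : joined (g e) y x by rewrite joinedC.
    have J1 : #|J| = #|J :\ j|.+1 by rewrite (cardsD1 j J) jJ.
    have same U l : l != i -> l != j -> linked g U (T l) ->
        linked (upd (upd g e (y, w)) h (x, x)) U (T l).
      move=> li lj; apply: linked_eq => f fl _ _.
      by rewrite /upd (negPf (joined_disjoint T_disjoint lj fl hT))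
        (negPf (joined_disjoint T_disjoint li fl ei)).
    (* The lifted edge keeps the name [e] and so stays in [T i], while [T j] loses its leaf edge
       [h]. The degree of [x] drops by 2 and [|J|] by 1, which preserves the bound. *)
    apply: (lift (J :\ j) e h y w) => //; [by rewrite J1|by rewrite J1 mulnS addnC| |].
    - move=> l; rewrite in_setD1 => /andP[lj lJl].
      case: (l =P i) => [->|/eqP li]; last exact: same (lJ l lJl).
      apply: linked_eq le => f fi _ _.
      by rewrite {1}/upd (negPf (joined_disjoint T_disjoint ij fi hT)).
    - move=> l; rewrite in_setD1 negb_and negbK.
      case: (l =P j) => [->|/eqP lj] /= lJl.
        have := linked_tdeg1 gW xW (lJ j jJ) tj; apply: linked_eq => f fj f1 f2.
        have fe : f != e by rewrite eq_sym; exact: (joined_disjoint T_disjoint ij ei fj).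
        have fh : f != h.
          apply: contraTneq f1 => fh; move: f2; rewrite fh !in_setD1.
          by case/orP: jh => /eqP -> /=; rewrite eqxx.
        by rewrite /upd (negPf fe) (negPf fh).
      apply: same (lJ' l lJl) => //.
      by apply: contraNneq lJl => ->.
  have [l|l] := linked_exchange gW (lJ i iJ) i1 i2 e12 j1 j2 y1x y2x wx wW.
    exact: fin i1 j1 y1x l.
  exact: fin i2 j2 y2x l.
have t2 : tdeg T g x i = 2%N.
  apply/eqP; rewrite eqn_leq ti andbT.
  have tge l : l \in J -> (2 <= tdeg T g x l)%N.
    move=> lJl; have := tpos l lJl; have := no1 l; rewrite inE lJl /=.
    by case: (tdeg T g x l) => [|[]].
  (* The degrees at [x] of the factors in [J] sum to at most [d(x) <= 2|J|], and each is at least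
     2. *)
  have : (tdeg T g x i + 2 * #|J :\ i| <= 2 * #|J|)%N.
    apply: leq_trans (leq_trans tsum _); last by move: deg; clear; lia.
    rewrite (big_setD1 i iJ) /= leq_add2l mulnC -sum_nat_const.
    by apply: leq_sum => l; rewrite in_setD1 => /andP[_ /tge].
  by rewrite (cardsD1 i J) iJ; clear; lia.
have j1' : joined (g e1) y1 x by rewrite joinedC.
have J1 : #|J| = #|J :\ i|.+1 by rewrite (cardsD1 i J) iJ.
have same U l : l != i -> linked g U (T l) ->
    linked (upd (upd g e1 (y1, y2)) e2 (x, x)) U (T l).
  move=> li; apply: linked_eq => f fl _ _.
  by rewrite /upd (negPf (joined_disjoint T_disjoint li fl i1))
    (negPf (joined_disjoint T_disjoint li fl i2)).
apply: (lift (J :\ i) e1 e2 y1 y2) => //; [by rewrite J1|by rewrite J1 mulnS addnC| |].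
  by move=> l; rewrite in_setD1 => /andP[li /lJ]; apply: same.
move=> l; rewrite in_setD1 negb_and negbK; case: (l =P i) => [->|/eqP li] /= lJl.
  apply: (linked_pair gW (lJ i iJ)) => // e ei ce.
  exact: (tdeg_le2 t2 e12).
exact: same (lJ' l lJl).
Qed.

Theorem orientable_linked g W b : balanced k g W b -> (forall i, linked g W (T i)) ->
  orientable k g W b.
Proof.
have [n] := ubnP #|W|; elim: n g W b => // n IHn g W b Wn bal lT.
have [gW par tot] := bal.
have [//|[A [AW A0 AT dA minA]]] := orientable_or_deficient k_gt1 gW par tot.
have /set0Pn[x xA] := A0.
have [Ax|A1] := set_split xA; last first.
  apply: (orientable_contract k_gt1 AW xA A1 par dA minA).
  apply: IHn.
  - by have := contracted_card AW xA A1; move: Wn; clear; lia.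
  - split; [exact: closed_contract|exact: even_at_contract|].
    by rewrite sum_push preimT.
  - by move=> i; apply: linked_contract.
subst A; have xW : x \in W by rewrite -sub1set.
have W1 : (1 < #|W|)%N.
  have [Wx|//] := set_split xW; by rewrite -Wx eqxx in AT.
apply: (@orientable_split g W b x setT) => //.
- move=> g' b' bal' lT'; apply: IHn => //.
  by move: Wn; rewrite (cardsD1 x W) xW.
- by move=> i; rewrite in_setT.
(* Deficiency and parity give [d(x) <= 2k - 4 + t(x)]; with [t(x) <= k] this becomes
   [d(x) + t(x) <= 4k - 4], twice the number of factors. *)
rewrite cardsT card_ord; move: dA; rewrite /deficient big_set1.
have := dist2k_le k_gt1 (b x); have [m hm] := balanced1 bal xW.
have [i hi] := dist2k_par k_gt1 (b x).
by move: hm hi k_gt1; clear; lia.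
Qed.

End TreeTheorem.

(** * Equitable colourings *)

Section Discrepancy.

Variables (V E : finType).
Implicit Types (g : E -> V * V).

(** Lifting pairs of edges at a vertex preserves all net out-degrees and ends with at most one
    non-loop at each vertex, where any orientation works. *)
Lemma net_le1 g : exists2 o, orients o & forall v, `|net g o [set v]| <= 1.
Proof.
have [n] := ubnP (nonloops g); elim: n g => // n IHn g gn.
case: (pickP [pred v | (1 < cutd g [set v])%N]) => [x /= c2|no].
  have c1 : (0 < cutd g [set x])%N by apply: leq_trans c2.
  have [e1 /crossing1P[u ux j1]] := cutd_gt0 c1.
  have [e2 e21 /crossing1P[w wx j2]] := cutd_gt1 e1 c2.
  have j1' : joined (g e1) u x by rewrite joinedC.
  have e12 : e1 != e2 by rewrite eq_sym.
  have [|o oo ho] := IHn (upd (upd g e1 (u, w)) e2 (x, x)).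
    exact: leq_trans (nonloops_lift x j1' j2 e12 ux wx) gn.
  have [o' [oo' _ _ ho']] := net_lift x j1' j2 e12 oo.
  by exists o' => // v; rewrite ho'.
exists (fun=> 1); first by left.
move=> v; have := no v; rewrite /= => /negbT; rewrite -leqNgt => cv.
apply: le_trans (_ : (cutd g [set v])%:Z <= 1); last by move: cv; clear; lia.
rewrite /net /cutd (big_morph _ PoszD (erefl _)).
apply: le_trans (ler_norm_sum _ _ _) _; apply: ler_sum => e _.
by rewrite mul1r /incidence /crossing; do 2 case: (_ \in _).
Qed.

(** A class consists of parallel, equally stored edges. Two of them are lifted to loops and receive
    opposite signs; in the end each class has at most one non-loop left, and [net_le1] applies. *)
Lemma net_class_le1 (M : eqType) (cl : E -> option M) g :
  (forall e1 e2, nonloop (g e1) -> nonloop (g e2) -> cl e1 != None -> cl e1 = cl e2 ->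
     g e1 = g e2) ->
  exists o, [/\ orients o, forall v, `|net g o [set v]| <= 1 &
    forall m, `|\sum_(e | nonloop (g e) && (cl e == Some m)) o e| <= 1].
Proof.
have [n] := ubnP (nonloops g); elim: n g => // n IHn g gn par.
case: (pickP [pred ee : E * E | [&& ee.1 != ee.2, nonloop (g ee.1), nonloop (g ee.2),
    cl ee.1 != None & cl ee.1 == cl ee.2]]) => [[e1 e2] /= /and5P[e12 n1 n2 cN /eqP c12]|no].
  have g12 := par _ _ n1 n2 cN c12.
  case gE : (g e1) => [u x]; have ux : u != x by move: n1; rewrite gE.
  have j1 : joined (g e1) u x by rewrite gE /joined eqxx.
  have j2 : joined (g e2) x u by rewrite -g12 gE /joined eqxx orbT.
  have [||o [oo ho hc]] := IHn (upd (upd g e1 (u, u)) e2 (x, x)).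
  - exact: leq_trans (nonloops_lift x j1 j2 e12 ux ux) gn.
  - have nl e : nonloop (upd (upd g e1 (u, u)) e2 (x, x) e) ->
        [/\ e != e1, e != e2 & nonloop (g e)].
      rewrite /upd; case: ifP => [_|_]; first by rewrite nonloop_refl.
      by case: ifP => [_|_]; first by rewrite nonloop_refl.
    move=> f1 f2 /nl[a1 a2 a3] /nl[b1 b2 b3] cf1 cf2.
    by rewrite /upd (negPf a1) (negPf a2) (negPf b1) (negPf b2); apply: par.
  have [o' [oo' oeq opp ho']] := net_lift x j1 j2 e12 oo.
  exists o'; split=> //; first by move=> v; rewrite ho'.
  move=> m; have := hc m; congr (`|_| <= 1).
  have e21 : e2 != e1 by rewrite eq_sym.
  have -> : \sum_(e | nonloop (g e) && (cl e == Some m)) o' e =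
      \sum_(e | [&& e != e1, e != e2, nonloop (g e) & cl e == Some m]) o' e.
    case: (boolP (cl e1 == Some m)) => cm.
      rewrite (bigD1 e1) /=; last by rewrite n1.
      rewrite (bigD1 e2) /=; last by rewrite n2 e21 -c12 cm.
      rewrite opp // addrA addNr add0r; apply: eq_bigl => e.
      by case: (e == e1); case: (e == e2); rewrite ?andbF ?andbT.
    apply: eq_bigl => e; case: (e =P e1) => [->|]; first by rewrite (negPf cm) andbF.
    by case: (e =P e2) => [->|//]; rewrite -c12 (negPf cm) andbF.
  apply: esym; apply: eq_big => [e|e]; last by case/and4P=> h1 h2 _ _; rewrite oeq.
  rewrite /upd; case: (e =P e2) => [->|] /=; first by rewrite nonloop_refl andbF.
  by case: (e =P e1) => [->|] //=; rewrite nonloop_refl.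
have [o oo ho] := net_le1 g; exists o; split=> // m.
case: (pickP [pred e | nonloop (g e) && (cl e == Some m)]) => [e0 /= /andP[n0 c0]|none].
  rewrite (big_pred1 e0); first by case: (oo e0) => ->.
  move=> e /=; apply/andP/eqP => [[ne ce]|->//].
  apply/eqP; apply: contraFT (no (e, e0)) => ee0 /=.
  by rewrite ee0 ne n0 (eqP ce) (eqP c0) eqxx.
by rewrite big_pred0.
Qed.

End Discrepancy.

Section Equitable.

Variables (E K : finType) (k : nat) (N : K -> {set E}).
Hypothesis k_gt0 : (0 < k)%N.
Hypothesis halving : forall F : {set E}, exists2 o : E -> int, orients o &
  forall c, `|\sum_(e in F :&: N c) o e| <= 1.

Definition cnt (c : {ffun E -> 'I_k}) (l : K) (i : 'I_k) : nat :=
  (\sum_(e in N l) (c e == i))%N.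

Lemma sum_cnt c l : (\sum_i cnt c l i = #|N l|)%N.
Proof.
rewrite /cnt exchange_big /= -sum1_card; apply: eq_bigr => e _.
by rewrite (bigD1 (c e)) //= eqxx big1 ?addn0 // => i /negPf; rewrite eq_sym => ->.
Qed.

Lemma sum_squares (a b a' b' : nat) : (a + b = a' + b')%N -> `|a'%:Z - b'%:Z| <= 1 ->
  (a' ^ 2 + b' ^ 2 <= a ^ 2 + b ^ 2)%N /\ ((b + 2 <= a)%N -> (a' ^ 2 + b' ^ 2 < a ^ 2 + b ^ 2)%N).
Proof.
move=> h1 h2.
have hd : (a'%:Z - b'%:Z) ^+ 2 <= (a%:Z - b%:Z) ^+ 2.
  have : `|a'%:Z - b'%:Z| <= `|a%:Z - b%:Z| by move: h1 h2; clear; lia.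
  move=> h; have := ler_pM (normr_ge0 _) (normr_ge0 _) h h.
  by rewrite -!normrM -!expr2 !ger0_norm ?sqr_ge0.
have hs : (a%:Z + b%:Z) ^+ 2 = (a'%:Z + b'%:Z) ^+ 2 by congr (_ ^+ 2); move: h1; clear; lia.
split; first by move: hd hs; clear; nia.
by move=> h3; move: h1 h2 h3 hs; clear; nia.
Qed.

(** A colouring minimizing the sum of the squares of the [cnt c l i] works: otherwise
    halving the union of two colour classes would decrease this sum. *)
Lemma equitable_coloring : exists c : {ffun E -> 'I_k},
  forall l i j, (cnt c l i <= cnt c l j + 1)%N.
Proof.
pose Phi (c : {ffun E -> 'I_k}) := (\sum_l \sum_i cnt c l i ^ 2)%N.
have c0 : {ffun E -> 'I_k} := [ffun=> Ordinal k_gt0].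
case: (arg_minnP (P := predT) Phi (i0 := c0) isT) => c _ cmin.
exists c => l0 i j; rewrite leqNgt; apply/negP => big.
have ij : i != j by apply: contraTneq big => ->; rewrite -leqNgt leq_addr.
pose F := [set e | (c e == i) || (c e == j)].
have [o oo ho] := halving F.
pose c' := [ffun e => if e \in F then (if o e == 1 then i else j) else c e].
have ji : (j == i) = false by rewrite eq_sym (negPf ij).
have other l h : h != i -> h != j -> cnt c' l h = cnt c l h.
  move=> hi hj; apply: eq_bigr => e _; rewrite ffunE inE.
  case: (c e =P i) => [->|_] /=.
    by case: (_ == 1); rewrite ![_ == h]eq_sym (negPf hi) ?(negPf hj).
  case: (c e =P j) => [->|_] //=.
  by case: (_ == 1); rewrite ![_ == h]eq_sym (negPf hj) ?(negPf hi).
have tot l : (cnt c l i + cnt c l j = cnt c' l i + cnt c' l j)%N.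
  rewrite /cnt -!big_split; apply: eq_bigr => e _; rewrite ffunE inE /=.
  case ei: (c e == i); case ej: (c e == j) => /=; rewrite ?ei ?ej //.
  - by move: ij; rewrite -(eqP ei) ej.
  - by case: (_ == 1); rewrite ?eqxx ?ji ?(negPf ij).
  - by case: (_ == 1); rewrite ?eqxx ?ji ?(negPf ij).
have dif l : `|(cnt c' l i)%:Z - (cnt c' l j)%:Z| <= 1.
  have := ho l; congr (`|_| <= 1).
  rewrite /cnt !(big_morph _ PoszD (erefl _)) -sumrB [RHS](big_setID F) /=.
  rewrite [X in _ = _ + X]big1 => [|e]; last first.
    rewrite inE => /andP[eF _]; rewrite ffunE (negPf eF).
    by move: eF; rewrite inE negb_or => /andP[/negPf -> /negPf ->].
  rewrite addr0 setIC; apply: eq_bigr => e; rewrite inE => /andP[_ eF]; rewrite ffunE eF.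
  by case: (oo e) => -> /=; rewrite eqxx ?ji ?(negPf ij).
have sq l : (\sum_h cnt c' l h ^ 2 <= \sum_h cnt c l h ^ 2)%N /\
    ((cnt c l j + 2 <= cnt c l i)%N -> (\sum_h cnt c' l h ^ 2 < \sum_h cnt c l h ^ 2)%N).
  rewrite (bigD1 i) //= (bigD1 j) /=; last by rewrite eq_sym.
  rewrite [X in (_ <= X)%N](bigD1 i) //= [X in (_ <= _ + X)%N](bigD1 j) /=; last by rewrite eq_sym.
  rewrite [X in (_ < X)%N](bigD1 i) //= [X in (_ < _ + X)%N](bigD1 j) /=; last by rewrite eq_sym.
  rewrite (eq_bigr (fun h => cnt c l h ^ 2)%N); last first.
    by move=> h /andP[hi hj]; rewrite other.
  have [s1 s2] := sum_squares (tot l) (dif l); rewrite !addnA leq_add2r ltn_add2r.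
  by split.
have := cmin c' isT; rewrite leqNgt => /negP; apply.
rewrite /Phi (bigD1 l0) //= [X in (_ < X)%N](bigD1 l0) //=.
have [_ s2] := sq l0; rewrite -addSn; apply: leq_add; first by apply: s2; move: big; clear; lia.
by apply: leq_sum => l _; have [] := sq l.
Qed.

Lemma cnt_exact c l (M : nat) : (forall i j, (cnt c l i <= cnt c l j + 1)%N) ->
  #|N l| = (k * M)%N -> forall i, cnt c l i = M.
Proof.
move=> eqc NM i; have := sum_cnt c l; rewrite NM (bigD1 i) //= => hs.
have card : (\sum_(j < k | j != i) 1 = k - 1)%N.
  by rewrite sum1_card cardC1 card_ord subn1.
have kM : ((k - 1) * M + M = k * M)%N by rewrite -[X in (_ + X)%N]mul1n -mulnDl subnK.
case: (ltngtP (cnt c l i) M) => // h.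
  have : (\sum_(j < k | j != i) cnt c l j <= \sum_(j < k | j != i) 1 * M)%N.
    by apply: leq_sum => j _; rewrite mul1n; have := eqc j i; move: h; clear; lia.
  rewrite -big_distrl /= card => h2.
  suff : (cnt c l i + \sum_(j < k | j != i) cnt c l j < k * M)%N by rewrite hs ltnn.
  by rewrite -kM [X in (_ < X)%N]addnC -addSn leq_add.
have : (\sum_(j < k | j != i) 1 * M <= \sum_(j < k | j != i) cnt c l j)%N.
  by apply: leq_sum => j _; rewrite mul1n; have := eqc i j; move: h; clear; lia.
rewrite -big_distrl /= card => h2.
suff : (k * M < cnt c l i + \sum_(j < k | j != i) cnt c l j)%N by rewrite hs ltnn.
by rewrite -kM addnC -addSn leq_add.
Qed.

Lemma cnt_le1 c l : (forall i j, (cnt c l i <= cnt c l j + 1)%N) ->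
  (#|N l| <= k)%N -> forall i, (cnt c l i <= 1)%N.
Proof.
move=> eqc Nk i; have := sum_cnt c l; rewrite (bigD1 i) //= => hs.
have card : (\sum_(j < k | j != i) 1 = k - 1)%N.
  by rewrite sum1_card cardC1 card_ord subn1.
rewrite leqNgt; apply/negP => h.
have : (\sum_(j < k | j != i) 1 <= \sum_(j < k | j != i) cnt c l j)%N.
  by apply: leq_sum => j _; have := eqc i j; move: h; clear; lia.
rewrite card => h2.
suff : (k < cnt c l i + \sum_(j < k | j != i) cnt c l j)%N by rewrite hs ltnNge Nk.
by apply: leq_trans (leq_add h h2); move: k_gt0; clear; lia.
Qed.

End Equitable.

(** * From orientations to factors *)

Section Decomposition.

Variables (V E : finType) (k : nat) (g : E -> V * V) (o : E -> int) (f : V -> nat).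
Hypotheses (k_gt0 : (0 < k)%N) (oo : orients o).
Hypothesis oP : forall v, cong k (net g o [set v]) (k * f v)%N%:Z.

Definition tail e : V := if o e == 1 then (g e).1 else (g e).2.

Definition head e : V := if o e == 1 then (g e).2 else (g e).1.

Definition outs v : nat := (\sum_(e | tail e == v) 1)%N.

Definition ins v : nat := (\sum_(e | head e == v) 1)%N.

Definition excess v : nat := (outs v %% k)%N.

Let slot : finType := (E + V * 'I_k)%type.

(** The dummy edges at [v] are the slots [inr (v, j)] with [j < k - excess v]. *)
Definition active (e : slot) : bool :=
  match e with inl _ => true | inr d => (d.2 < k - excess d.1)%N end.

Definition lnode (e : slot) : V := match e with inl e => tail e | inr d => d.1 end.

Definition rnode (e : slot) : V := match e with inl e => head e | inr d => d.1 end.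

Definition dummy (e : slot) : option V := match e with inl _ => None | inr d => Some d.1 end.

(** Three families are to be coloured equitably: the slots at the out-copy of a vertex, those at its
    in-copy, and the bundle of its dummies. The last makes the dummies at one vertex differ in
    colour. *)
Definition star (c : V + V + V) : {set slot} :=
  match c with
  | inl (inl v) => [set e | active e && (lnode e == v)]
  | inl (inr v) => [set e | active e && (rnode e == v)]
  | inr v => [set e | active e && (dummy e == Some v)]
  end.

Lemma net_outs v : net g o [set v] = (outs v)%:Z - (ins v)%:Z.
Proof.
rewrite /net /outs /ins [X in (X)%:Z - _]big_mkcond [X in _ - (X)%:Z]big_mkcond /=.
rewrite !(big_morph _ PoszD (erefl _)) -sumrB; apply: eq_bigr => e _.
rewrite /incidence /tail /head !in_set1.
by case: (oo e) => -> /=; do 2 case: (_ == v).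
Qed.

Lemma quotients v : exists m : int, [/\ (ins v %% k = excess v)%N &
  (outs v %/ k)%N%:Z = (ins v %/ k)%N%:Z + (f v)%:Z + 2 * m].
Proof.
have [m] := oP v; rewrite net_outs /excess.
rewrite {1}(divn_eq (outs v) k) {1}(divn_eq (ins v) k).
have := ltn_pmod (outs v) k_gt0; have := ltn_pmod (ins v) k_gt0.
move: (outs v %/ k)%N (outs v %% k)%N (ins v %/ k)%N (ins v %% k)%N => B s C s' hs' hs h.
have {h} h : (B%:Z - C%:Z - (f v)%:Z - 2 * m) * k%:Z = s'%:Z - s%:Z.
  by move: h; clear; lia.
suff h0 : B%:Z - C%:Z - (f v)%:Z - 2 * m = 0.
  exists m; move: h; rewrite h0 mul0r; split; last by move: h0; clear; lia.
  by move: h; clear; lia.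
move: (_ - 2 * m) h => i h; case: (ltrgtP i 0) => // i0.
  have : 0 <= (-1 - i) * k%:Z by apply: mulr_ge0; move: i0; clear; lia.
  by move: h hs hs'; clear; lia.
have : 0 <= (i - 1) * k%:Z by apply: mulr_ge0; move: i0; clear; lia.
by move: h hs hs'; clear; lia.
Qed.

(** Every slot leads from an out-copy to an in-copy, so the signed sum over the slots at a copy is a
    net out-degree up to sign. Slots that are inactive or outside [F] become loops, and the dummies
    at one vertex form a parallel class. *)
Lemma star_halving (F : {set slot}) : exists2 h : slot -> int, orients h &
  forall c, `|\sum_(e in F :&: star c) h e| <= 1.
Proof.
pose G (e : slot) : (V + V) * (V + V) :=
  if (e \in F) && active e then (inl (lnode e), inr (rnode e)) else (inl (lnode e), inl (lnode e)).
have nG e : nonloop (G e) = (e \in F) && active e.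
  by rewrite /G; case: ifP => _; rewrite ?nonloop_refl.
have [|h [oh hn hc]] := @net_class_le1 _ _ _ dummy G.
  move=> e1 e2; rewrite !nG /G => -> ->.
  by case: e1 e2 => [e1|d1] [e2|d2] //= _ [->].
have ll (a b : V) : (inl a == inl b :> V + V) = (a == b) by [].
have rr (a b : V) : (inr a == inr b :> V + V) = (a == b) by [].
have lr (a b : V) : (inl a == inr b :> V + V) = false by [].
have rl (a b : V) : (inr a == inl b :> V + V) = false by [].
exists h => // -[[v|v]|v].
- have := hn (inl v); congr (`|_| <= 1).
  rewrite /net [RHS]big_mkcond; apply: eq_bigr => e _.
  rewrite !inE /G /incidence; case: (boolP ((e \in F) && active e)) => [/andP[-> ->]|] /=.
    by rewrite !in_set1 ll rl subr0; case: (_ == _); rewrite ?mulr1 ?mulr0.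
  by rewrite subrr mulr0 andbA => /negPf ->.
- have := hn (inr v); rewrite -normrN; congr (`|_| <= 1).
  rewrite /net -sumrN [RHS]big_mkcond; apply: eq_bigr => e _.
  rewrite !inE /G /incidence; case: (boolP ((e \in F) && active e)) => [/andP[-> ->]|] /=.
    by rewrite !in_set1 rr lr sub0r mulrN opprK; case: (_ == _); rewrite ?mulr1 ?mulr0.
  by rewrite subrr mulr0 oppr0 andbA => /negPf ->.
- have := hc v; congr (`|_| <= 1); apply: eq_bigl => e.
  by rewrite !inE nG andbA.
Qed.

Lemma sum_pairs (F : V * 'I_k -> nat) : (\sum_d F d = \sum_u \sum_j F (u, j))%N.
Proof. by rewrite pair_bigA; apply: eq_bigr => -[]. Qed.

Lemma sum_slots (node : slot -> V) v (h : slot -> nat) :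
  (forall d, node (inr d) = d.1) ->
  (\sum_(e in [set e | active e && (node e == v)]) h e =
   \sum_(e | node (inl e) == v) h (inl e) +
   \sum_(j < k | (j < k - excess v)%N) h (inr (v, j)))%N.
Proof.
move=> hnode; rewrite big_mkcond big_sumType /=; congr (_ + _)%N.
  by rewrite [RHS]big_mkcond; apply: eq_bigr => e _; rewrite inE.
rewrite sum_pairs.
rewrite (bigD1 v) //= [X in (_ + X)%N]big1 ?addn0.
  by rewrite [RHS]big_mkcond; apply: eq_bigr => j _; rewrite inE hnode /= eqxx andbT.
by move=> u uv; rewrite big1 // => j _; rewrite inE hnode /= (negPf uv) andbF.
Qed.

Lemma sum_dummies v (h : slot -> nat) :
  (\sum_(e in star (inr v)) h e = \sum_(j < k | (j < k - excess v)%N) h (inr (v, j)))%N.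
Proof.
rewrite big_mkcond big_sumType /= big1 ?add0n; last by move=> e _; rewrite inE.
rewrite sum_pairs.
rewrite (bigD1 v) //= [X in (_ + X)%N]big1 ?addn0.
  by rewrite [RHS]big_mkcond; apply: eq_bigr => j _; rewrite inE /= eqxx andbT.
move=> u uv; rewrite big1 // => j _; rewrite inE /=.
by have -> : (Some u == Some v) = (u == v) by []; rewrite (negPf uv) andbF.
Qed.

Lemma count_ord n : (n <= k)%N -> (\sum_(j < k | (j < n)%N) 1 = n)%N.
Proof. by move=> nk; rewrite -(big_ord_widen k (fun=> 1%N) nk) sum1_card card_ord. Qed.

Lemma factorization : exists D : 'I_k -> {set E},
  [/\ \bigcup_(i < k) D i = [set: E],
   forall i j, i != j -> [disjoint D i & D j] &
   forall i v, exists a s d : nat, [/\ (s < k)%N, odd a = odd (f v),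
     (d <= 1)%N /\ (s = 0%N -> d = 0%N),
     (\sum_(e in D i) (((g e).1 == v) + ((g e).2 == v)) = a + 2 * d)%N &
     (\sum_(e in [set: E]) (((g e).1 == v) + ((g e).2 == v)) = k * a + 2 * s)%N]].
Proof.
have [c eqc] := equitable_coloring k_gt0 star_halving.
exists (fun i => [set e | c (inl e) == i]); split.
- apply/setP => e; rewrite in_setT; apply/bigcupP.
  by exists (c (inl e)); rewrite // inE.
- move=> i j ij; apply/pred0P => e /=; rewrite !inE.
  by case: (c (inl e) =P i) => //= ->; rewrite (negPf ij).
move=> i v; have [m [insk quot]] := quotients v.
have s_lt : (excess v < k)%N by apply: ltn_pmod.
pose B := (outs v %/ k)%N; pose C := (ins v %/ k)%N.
have outsE : outs v = (B * k + excess v)%N by apply: divn_eq.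
have insE : ins v = (C * k + excess v)%N by rewrite -insk; apply: divn_eq.
(* The dummies complete the degree of each copy to the next multiple of [k], also when [excess v] is
   0. *)
have No : #|star (inl (inl v))| = (k * B.+1)%N.
  rewrite -sum1_card sum_slots // count_ord ?leq_subr // -/(outs v) outsE.
  by move: s_lt; clear; rewrite mulnS [(k * B)%N]mulnC; lia.
have Ni : #|star (inl (inr v))| = (k * C.+1)%N.
  rewrite -sum1_card sum_slots // count_ord ?leq_subr // -/(ins v) insE.
  by move: s_lt; clear; rewrite mulnS [(k * C)%N]mulnC; lia.
have Nd : #|star (inr v)| = (k - excess v)%N.
  by rewrite -sum1_card sum_dummies count_ord ?leq_subr.
have co := cnt_exact k_gt0 (eqc (inl (inl v))) No i.
have ci := cnt_exact k_gt0 (eqc (inl (inr v))) Ni i.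
have cd : (cnt star c (inr v) i <= 1)%N.
  by apply: (cnt_le1 k_gt0 (eqc (inr v))); rewrite Nd leq_subr.
have cd0 : excess v = 0%N -> cnt star c (inr v) i = 1%N.
  move=> s0; apply: (cnt_exact k_gt0 (eqc (inr v))).
  by rewrite Nd s0 subn0 muln1.
have both (P : pred E) : (\sum_(e | P e) (((g e).1 == v) + ((g e).2 == v)) =
    \sum_(e | tail e == v) P e + \sum_(e | head e == v) P e)%N.
  rewrite [in LHS]big_mkcond [X in (_ = X + _)%N]big_mkcond [X in (_ = _ + X)%N]big_mkcond.
  rewrite -big_split; apply: eq_bigr => e _; rewrite /tail /head.
  by case: (oo e) => -> /=; do 2 case: (_ == v); case: (P e).
(* Colour [i] occurs [B + 1] times at the out-copy and [C + 1] times at the in-copy. A dummy of this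
   colour counts at both, so the real degree is [B + C] if there is one and [B + C + 2] if there is
   none. *)
exists (B + C)%N, (excess v), (1 - cnt star c (inr v) i)%N; split=> //.
- have := quot; rewrite -/B -/C => q.
  have -> : odd (f v) = odd (f v + 2 * `|m|) by rewrite oddD mul2n odd_double addbF.
  by move: q; clear; lia.
- by split; [clear; lia|move/cd0 ->].
- rewrite both.
  rewrite (eq_bigr (fun e => (c (inl e) == i) : nat)) => [|e _]; last by rewrite inE.
  rewrite [X in (_ + X)%N](eq_bigr (fun e => (c (inl e) == i) : nat)) => [|e _]; last first.
    by rewrite inE.
  move: co ci cd; rewrite /cnt sum_dummies.
  rewrite (sum_slots v (fun e => (c e == i) : nat)) //.
  rewrite (sum_slots v (fun e => (c e == i) : nat)) //=.
  by clear; lia.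
- rewrite both.
  rewrite (eq_bigr (fun=> 1%N)) => [|e _]; last by rewrite in_setT.
  rewrite [X in (_ + X)%N](eq_bigr (fun=> 1%N)) => [|e _]; last by rewrite in_setT.
  by rewrite -/(outs v) -/(ins v) outsE insE; clear; lia.
Qed.

End Decomposition.

(** * Translation to multigraphs and the proof of the theorem *)

Lemma cut_sizeE (G : multigraph) (X : {set vertex G}) : cut_size X = cutd (@ends G) X.
Proof.
rewrite /cut_size -sum1_card big_mkcond; apply: eq_bigr => e _.
by rewrite inE /crossing; case: (_ (+) _).
Qed.

Lemma connected_linked (G : multigraph) (F : {set edge G}) :
  connected_factor F -> linked (@ends G) setT F.
Proof.
move=> cF; apply/linkedP => A _ /set0Pn[u uA] AT.
have [v vA] : exists v, v \notin A.
  apply/existsP; apply: contraNT AT; rewrite negb_exists => /forallP h.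
  by rewrite eqEsubset subsetT; apply/subsetP => v _; have := h v; rewrite negbK.
apply/existsP; apply: contraNT vA; rewrite negb_exists => /forallP h.
have cl : closed (adjacent F) (mem A).
  move=> x y /existsP[e /andP[eF j]]; apply/eqP; rewrite -negb_add.
  have := h e; rewrite /cut_edge eF !in_setT /=.
  by case/orP: j => /eqP eE; rewrite /crossing eE //= addbC.
by rewrite -(closed_connect cl (cF u v)).
Qed.

Lemma odd_cutd (G : multigraph) (A : {set vertex G}) :
  (forall v, ~~ odd (degree [set: edge G] v)) -> ~~ odd (cutd (@ends G) A).
Proof.
move=> ev; have : ~~ odd (\sum_(v in A) degree [set: edge G] v).
  by elim/big_ind: _ => // m n; rewrite oddD => /negPf -> /negPf ->.
rewrite /degree exchange_big /=.
rewrite (eq_bigr (fun e => ((ends e).1 \in A) + ((ends e).2 \in A))%N); last first.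
  move=> e _; rewrite -!sumn_mem -big_split /=.
  by apply: eq_bigr => v _; rewrite !(eq_sym v).
apply: contraNN; rewrite /cutd.
have -> : (\sum_(e in [set: edge G]) (((ends e).1 \in A) + ((ends e).2 \in A)) =
    \sum_e crossing (ends e) A + 2 * \sum_e (((ends e).1 \in A) && ((ends e).2 \in A)))%N.
  rewrite big_distrr /= -big_split; apply: eq_big => [e|e _]; first by rewrite in_setT.
  by rewrite /crossing; do 2 case: (_ \in A).
by rewrite oddD mul2n odd_double addbF.
Qed.

Lemma natr_Z2 n : (n%:R : 'Z_2) = (odd n)%:R.
Proof.
rewrite -{1}(odd_double_half n) natrD -mul2n natrM.
have -> : (2%:R : 'Z_2) = 0 by apply/val_inj.
by rewrite mul0r addr0.
Qed.

Lemma sum_Z2 (I : finType) (A : {set I}) (f : I -> 'Z_2) :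
  \sum_(v in A) f v = (odd (\sum_(v in A) (f v : nat)))%:R.
Proof.
rewrite -natr_Z2 natr_sum; apply: eq_bigr => v _.
by rewrite natr_Zp.
Qed.

Lemma average_lt2 (k a s d : nat) : (0 < k)%N -> (s < k)%N -> (d <= 1)%N ->
  (s = 0%N -> d = 0%N) ->
  `|(a + 2 * d)%N%:R - (k * a + 2 * s)%N%:R / k%:R| < 2 :> rat.
Proof.
move=> k0 sk d1 sd.
have kR : (0 : rat) < k%:R by rewrite ltr0n.
have r1 : (s%:R / k%:R : rat) < 1 by rewrite ltr_pdivrMr // mul1r ltr_nat.
have r0 : (0 : rat) <= s%:R / k%:R by rewrite divr_ge0 ?ler0n.
have -> : ((a + 2 * d)%N%:R - (k * a + 2 * s)%N%:R / k%:R : rat) =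
    2 * d%:R - 2 * (s%:R / k%:R).
  by rewrite !natrD !natrM; field; rewrite (lt0r_neq0 kR).
case: d d1 sd => [|[|//]] _ sd.
  by rewrite mulr0 sub0r normrN ger0_norm; lra.
have s0 : (0 < s)%N by case: s sd {sk r1 r0} => // /(_ erefl).
have rp : (0 : rat) < s%:R / k%:R by rewrite divr_gt0 // ltr0n.
by rewrite mulr1 ger0_norm; lra.
Qed.

Local Close Scope ring_scope.

Theorem theorem4p4 (k : nat) (G : multigraph) (f : vertex G -> 'Z_2)
  (k_gt0 : 0 < k) (k_even : ~~ odd k)
  (G_even : forall v : vertex G, ~~ odd (degree [set: edge G] v))
  (f_sum : (\sum_(v : vertex G) f v = 0)%R)
  (G_conn :
    (forall X : {set vertex G},
       (\sum_(v in X) f v = 1)%R -> 3 * k - 2 <= cut_size X) \/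
    tree_connected G (2 * k - 2)) :
  exists D : 'I_k -> {set edge G},
    edge_decomposition D /\
    forall i : 'I_k,
      parity_factor f (D i) /\
      forall v : vertex G,
        (`|(degree (D i) v)%:R - (degree [set: edge G] v)%:R / k%:R| < 2 :> rat)%R.
Proof.
have k_gt1 : 1 < k by case: k k_gt0 k_even {G_conn} => [|[]].
pose h (v : vertex G) : nat := f v.
have closedT : closed_ends (@ends G) setT by move=> e _; rewrite !in_setT.
have evcut (A : {set vertex G}) : A \subset setT -> ~~ odd (cutd (@ends G) A).
  by move=> _; apply: odd_cutd.
have sumh : ~~ odd (\sum_(v in setT) h v).
  have : (\sum_(v in [set: vertex G]) f v = 0)%R.
    by rewrite -[RHS]f_sum; apply: eq_bigl => v; rewrite in_setT.
  by rewrite sum_Z2; case: (odd _).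
have [o oo oP] : orientable k (@ends G) setT (fun v => Posz (k * h v)).
  case: G_conn => [cut|[T [treeT disT]]].
    apply: orientable_parity => // A _ oA; rewrite -cut_sizeE; apply: cut.
    by rewrite sum_Z2 oA.
  apply: (orientable_linked k_gt1 disT); last by move=> i; apply: connected_linked; case: (treeT i).
  split=> //; first exact: even_at_parity.
  by rewrite sum_mulk; apply/half_cong.
have [|D [cover disj deg]] := factorization k_gt0 oo (f := h) (g := @ends G).
  by move=> v; apply: oP; rewrite in_setT.
exists D; split=> // i; split=> v; have [a [s [d [sk oa [d1 sd] degD degE]]]] := deg i v.
  rewrite /degree degD natr_Z2 oddD mul2n odd_double addbF oa -natr_Z2.
  exact: natr_Zp.
by rewrite /degree degD degE; apply: average_lt2.
Qed.
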